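(* Let $\pi=(\pi^{ij})$ be a (smooth) Poisson structure on $\mathbb{R}^d$, let $\overline{V}=-\pi^{ij}(x)p_i\partial_{x^j}$, and let $\alpha_{\overline V,\epsilon}:(T^*\mathbb{R}^d,\omega_0)\to(\mathbb{R}^d,\epsilon\pi)$ be the formal Karasev symplectic realization defined by $\overline V$, i.e. the unique formal series of the form $x+O(\epsilon)$ satisfying $\phi_\epsilon(\alpha_{\overline V,\epsilon}(x,p),p)=x$ for all $p$. Define recursively functions $I_t(\theta)$, $\theta\in[0,1)$, for topological rooted trees $t$ by $I_\bullet(\theta)=\frac12-\theta$ and $$I_t(\theta)=\int_0^1d\bar\lambda\int_\theta^{\bar\lambda}d\bar\theta\;I_{t_1}(\bar\theta)\cdots I_{t_m}(\bar\theta),\qquad t=[t_1,\dots,t_m].$$ Then, for $i=1,\dots,d$, $$\alpha^i_{\overline V,\epsilon}(p,x)=x^i+\sum_{t\in[RT]}\frac{\epsilon^{|t|}}{\sigma(t)}\,(-1)^{|t|}\,I_t(0)\,D^i_t\overline V.$$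
   Context: Coordinates on $T^*\mathbb{R}^d$ are $(x,p)$; repeated indices are summed; $\omega_0=dp_i\wedge dx^i$. $\phi_\epsilon^i(x,p)=\sum_{n\ge0}\frac{\epsilon^n}{(n+1)!}(L_{\overline V})^n(x^i)$, where $L_{\overline V}f=-\pi^{ij}(x)p_i\,\partial_{x^j}f$ (the formal expansion of $\frac1\epsilon\int_0^\epsilon(\varphi^{\overline V}_s)^*x^i\,ds$, $\varphi_s^{\overline V}$ the flow of $\overline V$). Formal composition: for $w_\epsilon^i=w_0^i+\epsilon\tilde w_\epsilon^i$ with $w_0^i\in C^\infty(T^*\mathbb{R}^d)$, $\tilde w^i_\epsilon\in C^\infty(T^*\mathbb{R}^d)[[\epsilon]]$, and $f\in C^\infty(T^*\mathbb{R}^d)$, the expression $f(w_\epsilon(x,p),p)$ means $\sum_{n\ge0}\frac{\epsilon^n}{n!}\tilde w_\epsilon^{i_1}\cdots\tilde w_\epsilon^{i_n}\big[\partial_{x^{i_1}}\cdots\partial_{x^{i_n}}f\big](w_0(x,p),p)$, extended $\epsilon$-linearly to formal series $f$. Trees: $[RT]$ is the set of isomorphism classes of (nonempty, finite) rooted trees, called topological rooted trees; $|t|$ is the number of vertices; $\sigma(t)$ is the number of automorphisms of the rooted tree $t$; $\bullet$ is the one-vertex tree; $[t_1,\dots,t_m]$ is the tree obtained by grafting the roots of $t_1,\dots,t_m$ onto a new root (order irrelevant). Elementary differentials of a vector field $X=X^i\partial_i$ on $\mathbb{R}^d$: $D^u_\bullet X=X^u(x)$ and $D^u_{[t_1,\dots,t_m]}X=\partial_{i_1}\cdots\partial_{i_m}X^u(x)\,D^{i_1}_{t_1}X\cdots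 D^{i_m}_{t_m}X$. For $\overline V$, regarded as a vector field on $\mathbb{R}^d$ depending on the parameter $p$, the derivatives are in $x$ with $p$ held fixed. *)

(* Defs.v *)
From HB Require Import structures.
From mathcomp Require Import all_boot all_order all_algebra.
From mathcomp Require Import all_classical all_reals all_analysis.
Set Implicit Arguments.
Unset Strict Implicit.
Unset Printing Implicit Defensive.
Import Order.TTheory GRing.Theory Num.Theory.
Import numFieldNormedType.Exports.
Local Open Scope ring_scope.

(* f is C^{k+1} iff it is Frechet differentiable and its derivative in every
   direction is C^k. *)
Fixpoint Ck (R : realType) (V : normedModType R) (k : nat) (f : V -> R)
    : Prop :=
  if k is k'.+1 then
    (forall x, differentiable f x) /\ (forall v, Ck k' (fun x => 'D_v f x))
  else continuous f.

Definition smooth (R : realType) (V : normedModType R) (f : V -> R) : Prop :=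
  forall k, Ck k f.

Record poisson_structure (R : realType) (d : nat)
    (P : 'rV[R]_d -> 'M[R]_d) : Prop := PoissonStructure {
  poisson_smooth : forall i j, smooth (fun x => P x i j);
  poisson_skew : forall x i j, P x i j = - P x j i;
  poisson_jacobi : forall x i j k,
    \sum_(l < d)
      (P x i l * 'D_(delta_mx 0 l) (fun y => P y j k) x
     + P x j l * 'D_(delta_mx 0 l) (fun y => P y k i) x
     + P x k l * 'D_(delta_mx 0 l) (fun y => P y i j) x) = 0 }.

(* Points (x, p) of T^*R^d. *)
Notation phase R d := ('rV[R]_d * 'rV[R]_d)%type.

Section FormalSeries.
Variables (R : realType) (d : nat).

Definition dx (j : 'I_d) (f : phase R d -> R) : phase R d -> R :=
  fun z => 'D_((delta_mx 0 j, 0) : phase R d) f z.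

Definition dxs (s : seq 'I_d) (f : phase R d -> R) : phase R d -> R := foldr dx f s.

(* \sum_n eps^n a_n is encoded as n |-> a_n; membership of the coefficients in
   C^oo(T^*R^d) is stated separately. *)
Definition fseries : Type := nat -> phase R d -> R.

Definition fone : fseries := fun n _ => (n == 0%N)%:R.

Definition fmul (a b : fseries) : fseries :=
  fun n z => \sum_(k < n.+1) a k z * b (n - k)%N z.

(* \sum_n eps^n (s n), for a sequence s of formal series. *)
Definition fsum (s : nat -> fseries) : fseries :=
  fun N z => \sum_(n < N.+1) s n (N - n)%N z.

Definition xcoord (i : 'I_d) : phase R d -> R := fun z => z.1 0 i.

Definition xseries (i : 'I_d) : fseries :=
  fun n z => if n == 0%N then xcoord i z else 0.

(* f(w_eps(x, p), p), where w_eps = w_0 + eps * wt_eps. *)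
Definition fcomp_fun (f : phase R d -> R) (w : 'I_d -> fseries) : fseries :=
  let w0 (z : phase R d) : phase R d := (\row_j w j 0%N z, z.2) in
  let wt (j : 'I_d) : fseries := fun n => w j n.+1 in
  fsum (fun n N z => n`!%:R^-1 *
    \sum_(i : n.-tuple 'I_d)
      (\big[fmul/fone]_(k < n) wt (tnth i k)) N z * dxs i f (w0 z)).

Definition fcomp (f : fseries) (w : 'I_d -> fseries) : fseries :=
  fsum (fun m => fcomp_fun (f m) w).

Variable P : 'rV[R]_d -> 'M[R]_d.

Definition Vbar (j : 'I_d) : phase R d -> R :=
  fun z => - \sum_(i < d) P z.1 i j * z.2 0 i.

Definition LVbar (f : phase R d -> R) : phase R d -> R :=
  fun z => \sum_(j < d) Vbar j z * dx j f z.

Definition phi (i : 'I_d) : fseries :=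
  fun n z => (n.+1)`!%:R^-1 * iter n LVbar (xcoord i) z.

Record karasev_realization (alpha : 'I_d -> fseries) : Prop :=
  KarasevRealization {
    karasev_smooth : forall i n, smooth (alpha i n);
    karasev_0 : forall i z, alpha i 0%N z = xcoord i z;
    karasev_phi : forall i n z, fcomp (phi i) alpha n z = xseries i n z }.

End FormalSeries.

(* Node [:: t_1; ..; t_m] is [t_1, .., t_m] for a given order of the branches,
   and Node [::] is the one-vertex tree.  Topological rooted trees are these
   plane trees up to isomorphism of rooted trees (RT below). *)
Inductive ptree : Type := Node of seq ptree.

HB.instance Definition _ := gen_eqMixin ptree.
HB.instance Definition _ := gen_choiceMixin ptree.

(* A vertex is given by the sequence of branch numbers leading to it from the
   root, which is [::]. *)
Fixpoint vertices (t : ptree) : seq (seq nat) :=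
  let: Node ts := t in
  let vs := map vertices ts in
  [::] :: flatten [seq [seq k :: v | v <- nth [::] vs k] | k <- iota 0 (size ts)].

Definition vertex (t : ptree) : finType := seq_sub (vertices t).

Lemma root_subproof (t : ptree) : [::] \in vertices t.
Proof. by case: t. Qed.

Definition troot (t : ptree) : vertex t := SeqSub (root_subproof t).

Definition is_child (t : ptree) (u v : vertex t) : Prop :=
  exists k, val v = rcons (val u) k.

Definition is_iso (t1 t2 : ptree) (f : vertex t1 -> vertex t2) : Prop :=
  [/\ bijective f, f (troot t1) = troot t2
    & forall u v, is_child u v <-> is_child (f u) (f v)].

Definition iso (t1 t2 : ptree) : bool :=
  `[< exists f : vertex t1 -> vertex t2, is_iso f >].

Lemma iso_refl : reflexive iso.
Proof. by move=> t; apply/asboolP; exists id; split=> //; exists id. Qed.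

Lemma iso_sym : symmetric iso.
Proof.
suff isoV t1 t2 : iso t1 t2 -> iso t2 t1 by move=> t1 t2; apply/idP/idP; exact: isoV.
move=> /asboolP[f [[g fK gK] fr fc]]; apply/asboolP; exists g; split.
- by exists f.
- by rewrite -fr fK.
- by move=> u v; rewrite -{1}(gK u) -{1}(gK v); split=> [/fc|?] //; apply/fc.
Qed.

Lemma iso_trans : transitive iso.
Proof.
move=> t2 t1 t3 /asboolP[f [fb fr fc]] /asboolP[g [gb gr gc]].
apply/asboolP; exists (g \o f); split.
- exact: bij_comp.
- by rewrite /= fr.
- by move=> u v; split=> [/fc/gc|/gc/fc].
Qed.

Canonical iso_equiv := EquivRel iso iso_refl iso_sym iso_trans.

(* The functions of a plane tree below are evaluated at a class through its
   representative (repr t); for smooth vector fields they are invariant under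
   isomorphism. *)
Definition RT : choiceType := {eq_quot iso}%qT.

Definition torder (t : ptree) : nat := #|vertex t|.

Definition sigma (t : ptree) : nat :=
  #|[pred f : {ffun vertex t -> vertex t} | `[< is_iso f >]]|.

Section Weights.
Variable R : realType.

(* In I_t the bound theta may exceed lambda. *)
Definition oriented_integral (a b : R) (f : R -> R) : R :=
  if a <= b then \int[lebesgue_measure]_(x in `[a, b]%classic) f x
  else - \int[lebesgue_measure]_(x in `[b, a]%classic) f x.

Fixpoint tweight (t : ptree) : R -> R :=
  let: Node ts := t in
  if ts is [::] then fun theta => 2^-1 - theta
  else let Is := map tweight ts in
    fun theta =>
      oriented_integral 0 1 (fun lambda =>
        oriented_integral theta lambda (fun theta' =>
          \prod_(I <- Is) I theta')).

End Weights.

Section ElementaryDifferential.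
Variables (R : realType) (d : nat) (X : 'I_d -> phase R d -> R).

(* For ts = [::] the value is X u, as D^u_\bullet X should be. *)
Fixpoint elementary_differential (t : ptree) (u : 'I_d) : phase R d -> R :=
  let: Node ts := t in
  let Ds := map elementary_differential ts in
  fun z => \sum_(i : (size ts).-tuple 'I_d)
    dxs i (X u) z * \prod_(k < size ts) nth (fun _ _ => 0) Ds k (tnth i k) z.

End ElementaryDifferential.

(* Main.v *)
(* The flow of Vbar, reparametrised as u(theta) with u(0) = alpha, satisfies
   u' = eps V(u) and has mean x over [0, 1], because phi_eps averages the flow.
   Hence u solves the fixed point equation
     u(theta) = x - eps \int_0^1 dlambda \int_theta^lambda V(u(theta')) dtheta',
   whose iterates are sums over plane trees with weights I_t(theta).  Conversely,
   for a solution u, the chain rule gives (d/dtheta) f(u) = eps (L_V f)(u), and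
   the Taylor expansion at theta = 0 of the mean of x^i(u) is the Karasev
   equation for u(0).  Plane trees are regrouped into isomorphism classes by
   counting the pairs of a plane tree and an isomorphism onto a given tree. *)
Require Import Defs.
From HB Require Import structures.
From mathcomp Require Import all_boot all_order all_algebra.
From mathcomp Require Import all_classical all_reals all_analysis.
From mathcomp Require Import ring zify.
Set Implicit Arguments.
Unset Strict Implicit.
Unset Printing Implicit Defensive.
Import Order.TTheory GRing.Theory Num.Theory.
Import numFieldNormedType.Exports.
Local Open Scope ring_scope.

(** * Smooth functions *)

(** No flow is integrated. At a fixed point z = (x, p), everything is computed modulo eps^{N+1} in
    R[theta][eps], and f(x + U, p) is replaced by its Taylor polynomial of order N, where U is
    divisible by eps. The weights are polynomials in theta, so integrals over [0, 1] and
    theta-derivatives act on coefficients, and the Taylor expansion in theta is a finite sum. The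
    operator J p(theta) = \int_0^1 dlambda \int_theta^lambda p gives the antiderivative of -p with
    mean 0; these two properties turn u = x - eps J(V(u)) into u' = eps V(u) with mean x. Every
    vertex of a tree comes from one application of -eps J, whence (-1)^{|t|} eps^{|t|}. Each
    iteration gains one power of eps, so N iterations from U = 0 suffice modulo eps^{N+1}.
    Uniqueness is seen order by order: the leading term of phi is x, and every later term carries a
    power of eps, so the equation at eps^n determines the n-th coefficient of alpha from the
    previous ones. *)

Section Smooth.
Variables (R : realType) (V : normedModType R).
Implicit Types (f g : V -> R) (k : nat).

Lemma CkS k f : Ck k.+1 f -> Ck k f.
Proof.
elim: k f => [|k IH] f /= [df Df].
  by move=> x; exact/differentiable_continuous.
by split=> // v; exact: (IH _ (Df v)).
Qed.

Lemma Ck_cst k (c : R) : Ck k (fun _ : V => c).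
Proof.
elim: k c => [|k IH] c /=; first by move=> x; exact: cst_continuous.
split=> [x|v]; first exact: differentiable_cst.
rewrite (_ : 'D_v _ = fun=> 0); first exact: IH.
by apply/funext => x; exact: derive_cst.
Qed.

Lemma CkD k f g : Ck k f -> Ck k g -> Ck k (fun x => f x + g x).
Proof.
elim: k f g => [|k IH] f g /=; first by move=> cf cg x; apply: cvgD; [exact: cf|exact: cg].
move=> [df Df] [dg Dg]; split=> [x|v]; first by apply: (@differentiableD _ _ _ f g).
rewrite [X in Ck k X](_ : _ = fun x => 'D_v f x + 'D_v g x); first exact: IH.
by apply/funext => x; rewrite -(@deriveD _ _ _ f g)//; exact: diff_derivable.
Qed.

Lemma CkM k f g : Ck k f -> Ck k g -> Ck k (fun x => f x * g x).
Proof.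
elim: k f g => [|k IH] f g; first by move=> cf cg x; apply: cvgM; [exact: cf|exact: cg].
move=> Cf Cg; have [df Df] := Cf; have [dg Dg] := Cg.
split=> [x|v]; first by apply: (@differentiableM _ _ f g).
rewrite [X in Ck k X](_ : _ = fun x => f x * 'D_v g x + g x * 'D_v f x).
  by apply: CkD; apply: IH; [exact: CkS|exact: Dg|exact: CkS|exact: Df].
by apply/funext => x; rewrite -(@deriveM _ _ f g)//; exact: diff_derivable.
Qed.

Lemma smooth_cst (c : R) : smooth (fun _ : V => c).
Proof. by move=> k; exact: Ck_cst. Qed.

Lemma smoothD f g : smooth f -> smooth g -> smooth (fun x => f x + g x).
Proof. by move=> sf sg k; exact: CkD. Qed.

Lemma smoothM f g : smooth f -> smooth g -> smooth (fun x => f x * g x).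
Proof. by move=> sf sg k; exact: CkM. Qed.

Lemma smoothN f : smooth f -> smooth (fun x => - f x).
Proof.
move=> sf; rewrite (_ : (fun x => - f x) = fun x => -1 * f x).
  by apply: smoothM => //; exact: smooth_cst.
by apply/funext => x; rewrite mulN1r.
Qed.

Lemma smooth_sum (I : Type) (r : seq I) (Q : pred I) (F : I -> V -> R) :
  (forall i, smooth (F i)) -> smooth (fun x => \sum_(i <- r | Q i) F i x).
Proof.
move=> sF; elim: r => [|i r IH].
  rewrite (_ : (fun x => \sum_(i <- _ | _) _) = fun=> 0); first exact: smooth_cst.
  by apply/funext => x; rewrite big_nil.
case Qi: (Q i); last by under eq_fun do rewrite big_cons Qi.
by under eq_fun do rewrite big_cons Qi; exact: smoothD.
Qed.

Lemma smooth_prod (I : Type) (r : seq I) (Q : pred I) (F : I -> V -> R) :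
  (forall i, smooth (F i)) -> smooth (fun x => \prod_(i <- r | Q i) F i x).
Proof.
move=> sF; elim: r => [|i r IH].
  rewrite (_ : (fun x => \prod_(i <- _ | _) _) = fun=> 1); first exact: smooth_cst.
  by apply/funext => x; rewrite big_nil.
case Qi: (Q i); last by under eq_fun do rewrite big_cons Qi.
by under eq_fun do rewrite big_cons Qi; exact: smoothM.
Qed.

Lemma smooth_derive f v : smooth f -> smooth (fun x => 'D_v f x).
Proof. by move=> sf k; exact: (sf k.+1).2. Qed.

Lemma smooth_differentiable f x : smooth f -> differentiable f x.
Proof. by move=> /(_ 1%N)[]. Qed.

Lemma smooth_continuous f : smooth f -> continuous f.
Proof. by move=> /(_ 0%N). Qed.

Lemma is_derive_line f x v (t : R) : smooth f ->
  is_derive t 1 (fun s => f (x + s *: v)) ('D_v f (x + t *: v)).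
Proof.
move=> sf.
have E : (fun h : R => h^-1 *: (f (x + (h *: 1 + t) *: v) - f (x + t *: v)))
       = (fun h => h^-1 *: (f (h *: v + (x + t *: v)) - f (x + t *: v))).
  by apply/funext => h; rewrite [h *: 1]mulr1 scalerDl addrCA.
have D : derivable f (x + t *: v) v by exact/diff_derivable/smooth_differentiable.
by apply: DeriveDef; rewrite /derivable /derive /= E.
Qed.

Lemma mean_value_line f x v (h : R) : smooth f -> 0 < h ->
  exists2 c, 0 < c < h & f (x + h *: v) - f x = h * 'D_v f (x + c *: v).
Proof.
move=> sf h0.
have [t _|//|c] := @MVT R (fun s => f (x + s *: v)) (fun s => 'D_v f (x + s *: v)) 0 h h0.
- exact: is_derive_line.
- apply: derivable_within_continuous => t _.
  by have := is_derive_line x v t sf => -[].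
by rewrite in_itv /= scale0r addr0 subr0 mulrC => ch ->; exists c.
Qed.

(** The mean value theorem is used twice: along u for s |-> f(x + h v + s u) - f(x + s u), then
    along v for the derivative of f in direction u. *)
Lemma second_difference f x u v (h : R) : smooth f -> 0 < h ->
  exists a b, [/\ 0 < a < h, 0 < b < h &
    f (x + h *: u + h *: v) - f (x + h *: u) - (f (x + h *: v) - f x)
    = h * (h * 'D_v (fun y => 'D_u f y) (x + a *: u + b *: v))].
Proof.
move=> sf h0; pose g s := f (x + h *: v + s *: u) - f (x + s *: u).
pose dg s : R := 'D_u f (x + h *: v + s *: u) - 'D_u f (x + s *: u).
have gd (t : R) : is_derive t (1 : R) g (dg t).
  by apply: is_deriveB; exact: is_derive_line.
have [|a] := @MVT R g dg 0 h h0 (fun t _ => gd t).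
  by apply: derivable_within_continuous => t _; have [] := gd t.
rewrite in_itv /= /g /dg scale0r !addr0 subr0 => ah E.
have [b bh Eb] := mean_value_line (x + a *: u) v (smooth_derive u sf) h0.
exists a, b; split=> //.
by rewrite -Eb (addrAC x (h *: u)) E mulrC (addrAC x (a *: u)).
Qed.

(* Applied in both orders, the second difference yields the two mixed derivatives
   at points arbitrarily close to [x]. *)
Lemma derive_swap f u v x : smooth f ->
  'D_v (fun y => 'D_u f y) x = 'D_u (fun y => 'D_v f y) x.
Proof.
move=> sf.
have cuv : continuous (fun y => 'D_v (fun y => 'D_u f y) y).
  exact/smooth_continuous/smooth_derive/smooth_derive.
have cvu : continuous (fun y => 'D_u (fun y => 'D_v f y) y).
  exact/smooth_continuous/smooth_derive/smooth_derive.
set F := (fun y => _) in cuv; set G := (fun y => _) in cvu.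
rewrite -/(F x) -/(G x).
apply/eqP; rewrite -subr_eq0 -normr_le0; apply/ler_addgt0Pr => e e0.
rewrite add0r.
have e20 : 0 < e / 2 by rewrite divr_gt0.
have /cvgrPdist_lt/(_ _ e20) nF := cuv x.
have /cvgrPdist_lt/(_ _ e20) nG := cvu x.
have /nbhs_ballP[r /= r0 rFG] :
    nbhs x (fun y => `|F x - F y| < e / 2 /\ `|G x - G y| < e / 2).
  exact: filterI nF nG.
(* With this [h], all points x + a u + b v with 0 < a, b < h lie in the ball of radius [r]; the
   summand 1 keeps the denominator positive when u = v = 0. *)
pose h := r / (`|u| + `|v| + 1).
have D0 : 0 < `|u| + `|v| + 1 by rewrite ltr_wpDl// addr_ge0.
have h0 : 0 < h by rewrite divr_gt0.
have near_pt a b : 0 < a < h -> 0 < b < h -> ball x r (x + a *: u + b *: v).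
  move=> /andP[a0 ah] /andP[b0 bh]; rewrite -ball_normE /ball_ /=.
  rewrite -addrA opprD addNKr normrN (le_lt_trans (ler_normD _ _))//.
  rewrite !normrZ !gtr0_norm//.
  have -> : r = h * `|u| + h * `|v| + h.
    by rewrite -[X in _ + X]mulr1 -!mulrDr /h divfK// gt_eqF.
  by rewrite ltr_pwDr// lerD// ler_wpM2r// ltW.
have [a [b [ah bh E1]]] := second_difference x u v sf h0.
have [b' [a' [bh' ah' E2]]] := second_difference x v u sf h0.
have S : f (x + h *: u + h *: v) - f (x + h *: u) - (f (x + h *: v) - f x)
       = f (x + h *: v + h *: u) - f (x + h *: v) - (f (x + h *: u) - f x).
  have aux (A B C D : R) : A - B - (C - D) = A - C - (B - D) by ring.
  by rewrite (addrAC x (h *: u)) aux.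
have FG : F (x + a *: u + b *: v) = G (x + b' *: v + a' *: u).
  have hn : h != 0 by rewrite gt_eqF.
  by apply: (mulfI hn); apply: (mulfI hn); exact: etrans (esym E1) (etrans S E2).
have [F1 _] := rFG _ (near_pt _ _ ah bh).
have [_ G1] := rFG _ (near_pt _ _ ah' bh').
rewrite (addrAC x (a' *: u)) in G1.
rewrite FG in F1; rewrite distrC in G1.
rewrite [e]splitr -(subrKA (G (x + b' *: v + a' *: u))).
apply: le_trans (ler_normD _ _) _.
by apply: lerD; apply: ltW; [exact: F1|exact: G1].
Qed.

End Smooth.

Lemma Ck_comp_fst (R : realType) (V W : normedModType R) k (f : V -> R) :
  Ck k f -> Ck k (fun z : V * W => f z.1).
Proof.
elim: k f => [|k IH] f /=.
  move=> cf z; apply: (@continuous_comp _ _ _ fst f); first exact: cvg_fst.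
  exact: cf.
move=> [df Df]; split=> [z|v].
  apply: (@differentiable_comp _ _ _ _ fst f); last exact: df.
  by apply: (@linear_differentiable R (V * W)%type V fst) => y; exact: cvg_fst.
rewrite (_ : 'D_v _ = fun z : V * W => 'D_(v.1) f z.1).
  exact: (IH _ (Df _)).
(* The difference quotients of both sides are convertible, since the first projection computes
   through addition and scaling. *)
by apply/funext.
Qed.

Section SmoothLinear.
Variables (R : realType) (V : normedModType R) (f : V -> R).
Hypotheses (lf : linear_for *%R f) (cf : continuous f).

Let fL : {linear V -> R^o} :=
  HB.pack f (GRing.isLinear.Build R V R^o *%R f lf).

Lemma derive_linear v x : 'D_v f x = f v.
Proof.
have df : differentiable (fL : V -> R^o) x by exact: linear_differentiable.
have := deriveE v df; rewrite (diff_lin x) //.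
Qed.

Lemma smooth_linear : smooth f.
Proof.
move=> [|k]; first exact: cf.
split=> [x|v]; first exact: (@linear_differentiable _ _ _ fL).
rewrite (_ : 'D_v _ = fun=> f v); first exact: Ck_cst.
by apply/funext => x; exact: derive_linear.
Qed.

End SmoothLinear.

(** * Coordinates and iterated x-derivatives on phase space *)

Section PhaseSpace.
Variables (R : realType) (d : nat).
Implicit Types f g : phase R d -> R.

Let linear_xcoord i : linear_for *%R (@xcoord R d i).
Proof. by move=> a u v; rewrite /xcoord /= !mxE. Qed.

Let continuous_xcoord i : continuous (@xcoord R d i).
Proof.
move=> z; apply: (@continuous_comp _ _ _ fst (fun x : 'rV[R]_d => x 0 i)).
  exact: cvg_fst.
exact: coord_continuous.
Qed.

Lemma smooth_xcoord i : smooth (@xcoord R d i).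
Proof. exact: smooth_linear. Qed.

Lemma smooth_pcoord (i : 'I_d) : smooth (fun z : phase R d => z.2 0 i).
Proof.
apply: smooth_linear => [a u v|z]; first by rewrite /= !mxE.
apply: (@continuous_comp _ _ _ snd (fun x : 'rV[R]_d => x 0 i)).
  exact: cvg_snd.
exact: coord_continuous.
Qed.

Lemma dx_xcoord i j : dx j (@xcoord R d i) = fun=> (i == j)%:R.
Proof.
by apply/funext => z; rewrite /dx derive_linear// /xcoord mxE eqxx eq_sym.
Qed.

Lemma smooth_dx j f : smooth f -> smooth (dx j f).
Proof. exact: smooth_derive. Qed.

Lemma dxC i j f : smooth f -> dx i (dx j f) = dx j (dx i f).
Proof. by move=> sf; apply/funext => z; exact: derive_swap. Qed.

Lemma dxD j f g z : smooth f -> smooth g ->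
  dx j (fun y => f y + g y) z = dx j f z + dx j g z.
Proof.
by move=> sf sg; apply: (@deriveD _ _ _ f g);
  exact/diff_derivable/smooth_differentiable.
Qed.

Lemma dxM j f g z : smooth f -> smooth g ->
  dx j (fun y => f y * g y) z = f z * dx j g z + g z * dx j f z.
Proof.
by move=> sf sg; apply: (@deriveM _ _ f g);
  exact/diff_derivable/smooth_differentiable.
Qed.

Lemma dx_cst j (c : R) : dx j (fun _ : phase R d => c) = fun=> 0.
Proof. by apply/funext => z; exact: derive_cst. Qed.

Lemma smooth_dxs s f : smooth f -> smooth (dxs s f).
Proof. by move=> sf; elim: s => //= j s; exact: smooth_dx. Qed.

Lemma dxs_dx s j f : smooth f -> dxs s (dx j f) = dx j (dxs s f).
Proof.
by move=> sf; elim: s => //= i s ->; rewrite dxC//; exact: smooth_dxs.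
Qed.

Lemma dxs_perm s1 s2 f : smooth f -> perm_eq s1 s2 -> dxs s1 f = dxs s2 f.
Proof.
move=> sf; apply: (catCA_perm_subst (F := fun s => dxs s f)) => {s1 s2} s1 s2 s3.
rewrite /dxs !foldr_cat -!/(dxs _ _).
have := smooth_dxs s3 sf; move: (dxs s3 f) => g sg.
elim: s1 => //= i s1 ->; rewrite -/(dxs s1 g) -/(dxs s2 _) dxs_dx//.
exact: smooth_dxs.
Qed.

End PhaseSpace.

(** * Polynomial weights *)

Section PolynomialIntegral.
Variable R : realType.
Implicit Types p q : {poly R}.

(* The constant coefficient is p`_0 / 0 = 0. *)
Definition primitive p : {poly R} :=
  \poly_(i < (size p).+1) (p`_i.-1 / i%:R).

Definition int01 p : R := (primitive p).[1].

(* [\int_0^1 dlambda \int_theta^lambda p], as a polynomial in [theta]. *)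
Definition weight_integral p : {poly R} :=
  (int01 (primitive p))%:P - primitive p.

Lemma coef_primitive p i : (primitive p)`_i = p`_i.-1 / i%:R.
Proof.
rewrite coef_poly; case: ltnP => // pi.
by rewrite nth_default ?mul0r//; case: i pi.
Qed.

Lemma primitive_is_linear : linear primitive.
Proof.
move=> a p q; apply/polyP => i.
by rewrite coefD coefZ !coef_primitive coefD coefZ mulrDl mulrA.
Qed.
HB.instance Definition _ :=
  GRing.isLinear.Build R {poly R} {poly R} _ primitive primitive_is_linear.

Lemma deriv_primitive p : (primitive p)^`() = p.
Proof.
by apply/polyP => i; rewrite coef_deriv coef_primitive -(mulr_natr (_ / _)) divfK ?pnatr_eq0.
Qed.

Lemma horner0_primitive p : (primitive p).[0] = 0.
Proof. by rewrite horner_coef0 coef_primitive invr0 mulr0. Qed.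

Lemma int01_is_linear : linear_for *%R int01.
Proof. by move=> a p q; rewrite /int01 linearP hornerD hornerZ. Qed.
HB.instance Definition _ :=
  GRing.isLinear.Build R {poly R} R _ int01 int01_is_linear.

Lemma primitiveC (c : R) : primitive c%:P = c *: 'X.
Proof.
apply/polyP => -[|[|i]]; rewrite coef_primitive coefZ coefX coefC ?invr0 ?mulr0//.
  by rewrite divr1 mulr1.
by rewrite mul0r.
Qed.

Lemma int01C (c : R) : int01 c%:P = c.
Proof. by rewrite /int01 primitiveC hornerZ hornerX mulr1. Qed.

Lemma weight_integral_is_linear : linear weight_integral.
Proof.
move=> a p q; rewrite /weight_integral !linearP /= polyCD polyCM -mul_polyC.
by rewrite mulrBr -mul_polyC; ring.
Qed.
HB.instance Definition _ :=
  GRing.isLinear.Build R {poly R} {poly R} _ weight_integral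
    weight_integral_is_linear.

Lemma deriv_weight_integral p : (weight_integral p)^`() = - p.
Proof. by rewrite derivB derivC sub0r deriv_primitive. Qed.

Lemma int01_weight_integral p : int01 (weight_integral p) = 0.
Proof. by rewrite linearB /= int01C subrr. Qed.

(** The integral of theta^m is 1/(m+1), and the m-th derivative at 0 is m! times the coefficient;
    the resulting 1/(m+1)! is the factor in [phi]. *)
Lemma int01_taylor p n : (size p <= n)%N ->
  int01 p = \sum_(m < n) p^`(m).[0] / (m.+1)`!%:R.
Proof.
move=> pn; rewrite /int01 (@horner_coef_wide _ n.+1); last first.
  by apply: (leq_trans (size_poly _ _)).
rewrite big_ord_recl coef_primitive invr0 mulr0 mul0r add0r.
apply: eq_bigr => i _; rewrite expr1n mulr1 coef_primitive /=.
rewrite horner_coef0 coef_derivn addn0 ffactnn factS natrM -(mulr_natr p`_i).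
by rewrite invfM mulrACA divff ?mulr1// pnatr_eq0 -lt0n fact_gt0.
Qed.

(** This is the weight of the one-vertex tree, which thus obeys the general recursion with an empty
    product; [weight_poly] has one clause for all trees. *)
Lemma weight_integral1 : weight_integral 1 = (2^-1)%:P - 'X.
Proof.
rewrite /weight_integral -[1]/(1%:P) primitiveC scale1r; congr (_%:P - _).
rewrite (@int01_taylor _ 2) ?size_polyX// !big_ord_recl big_ord0 /=.
by rewrite hornerX derivX hornerC mul0r add0r addr0 mul1r.
Qed.

Lemma oriented_integral_horner a b p :
  oriented_integral a b (horner p) = (primitive p).[b] - (primitive p).[a].
Proof.
have itv x y : x <= y ->
    \int[lebesgue_measure]_(t in `[x, y]%classic) p.[t]
    = (primitive p).[y] - (primitive p).[x].
  rewrite le_eqVlt => /predU1P[->|xy].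
    by rewrite set_itv1 Rintegral_set1 subrr.
  rewrite /Rintegral (@continuous_FTC2 _ _ (horner (primitive p)))//.
  - exact/continuous_subspaceT/continuous_horner.
  - split.
    + by move=> t _; exact: derivable_horner.
    + by apply: cvg_at_right_filter; exact: continuous_horner.
    + by apply: cvg_at_left_filter; exact: continuous_horner.
  - by move=> t _; rewrite -derivE deriv_primitive.
rewrite /oriented_integral; case: (leP a b) => [/itv//|/ltW/itv ->].
by rewrite opprB.
Qed.

End PolynomialIntegral.

(** The principle generated for this nested inductive type has no hypothesis on the branches. Here
    they are addressed by position, as in the sums and products over branches below. *)
Lemma ptree_nth_ind (Q : ptree -> Prop) :
  (forall ts, (forall k, (k < size ts)%N -> Q (nth (Node [::]) ts k)) ->
     Q (Node ts)) ->
  forall t, Q t.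
Proof.
move=> QN; fix IH 1 => -[ts]; apply: QN.
(* Clearing [IH] keeps [by] from applying it to a tree that is not a structural subterm. *)
elim: ts => [|t ts IHts] [|k] kts;
  [by clear IH|by clear IH|exact: IH|exact: IHts].
Qed.

Section PolynomialWeight.
Variable R : realType.

Fixpoint weight_poly (t : ptree) : {poly R} :=
  let: Node ts := t in weight_integral (\prod_(p <- map weight_poly ts) p).

Lemma tweight_poly t : tweight t = horner (weight_poly t).
Proof.
elim/ptree_nth_ind: t => ts IH.
have JE p th : oriented_integral 0 1 (fun lambda : R =>
    oriented_integral th lambda (horner p)) = (weight_integral p).[th].
  under eq_fun do rewrite oriented_integral_horner.
  rewrite (_ : (fun _ => _) = horner (primitive p - ((primitive p).[th])%:P)).
    rewrite oriented_integral_horner horner0_primitive subr0 -/(int01 _).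
    by rewrite /weight_integral linearB /= int01C hornerD hornerN hornerC.
  by apply/funext => l; rewrite hornerD hornerN hornerC.
case: ts IH => [|t ts] IH /=.
  by apply/funext => th; rewrite big_nil weight_integral1 hornerD hornerN hornerC hornerX.
apply/funext => th; rewrite -JE.
congr oriented_integral; apply/funext => l; congr oriented_integral.
apply/funext => th'; rewrite -!map_cons !big_map horner_prod.
by rewrite !(big_nth (Node [::])); apply: eq_big_nat => k /IH ->.
Qed.

End PolynomialWeight.

(** * Truncated Taylor expansion *)

Section Truncation.
Variable A : comNzRingType.
Implicit Types p q : {poly A}.

(** Congruence modulo 'X^(N+1): the coefficient of index [N] is included. *)
Definition eqmodX (N : nat) p q := forall m, (m <= N)%N -> p`_m = q`_m.

Lemma eqmodX_refl N p : eqmodX N p p. Proof. by []. Qed.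

Lemma eqmodX_trans N p q r : eqmodX N p q -> eqmodX N q r -> eqmodX N p r.
Proof. by move=> pq qr m mN; rewrite pq// qr. Qed.

Lemma eqmodXM N p p' q q' :
  eqmodX N p p' -> eqmodX N q q' -> eqmodX N (p * q) (p' * q').
Proof.
move=> pp qq m mN; rewrite !coefM; apply: eq_bigr => i _.
rewrite pp ?qq//; first by rewrite (leq_trans (leq_subr _ _)).
by rewrite (leq_trans _ mN)// -ltnS.
Qed.

Lemma eqmodX_sum N (I : finType) (F G : I -> {poly A}) :
  (forall i, eqmodX N (F i) (G i)) -> eqmodX N (\sum_i F i) (\sum_i G i).
Proof. by move=> FG m mN; rewrite !coef_sum; apply: eq_bigr => i _; exact: FG. Qed.

(** Orders of vanishing at 0 add up under multiplication. *)
Lemma coefM_lt p q k l m : (forall i, (i < k)%N -> p`_i = 0) ->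
  (forall i, (i < l)%N -> q`_i = 0) -> (m < k + l)%N -> (p * q)`_m = 0.
Proof.
move=> pk ql mkl; rewrite coefM big1// => i _.
have [ik|ki] := ltnP i k; first by rewrite pk ?mul0r.
by rewrite ql ?mulr0//; have := ltn_ord i; lia.
Qed.

End Truncation.

Lemma big_tuple_cons (A : nmodType) (T : finType) n (F : n.+1.-tuple T -> A) :
  \sum_i F i = \sum_j \sum_(t : n.-tuple T) F [tuple of j :: t].
Proof.
rewrite pair_big /= (reindex (fun p : T * n.-tuple T => [tuple of p.1 :: p.2])) //=.
exists (fun t => (thead t, [tuple of behead t])) => [[j t] _|t _] /=.
  by rewrite theadE; congr pair; exact: val_inj.
by rewrite -tuple_eta.
Qed.

(** * Jets along a formal displacement *)

Section Jets.
Variables (R : realType) (d : nat) (Q : comNzRingType) (c : {rmorphism R -> Q}).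
Variable z : phase R d.
Implicit Types (f g : phase R d -> R) (U : 'I_d -> Q).

(* [jet U n f] is [(U . d/dx)^n f] at [z], with [U] treated as constant. *)
Fixpoint jet U n f : Q :=
  if n is n'.+1 then \sum_(j < d) U j * jet U n' (dx j f) else c (f z).

Lemma jetD U n f g : smooth f -> smooth g ->
  jet U n (fun y => f y + g y) = jet U n f + jet U n g.
Proof.
elim: n f g => [|n IH] f g sf sg /=; first exact: rmorphD.
rewrite -big_split; apply: eq_bigr => j _ /=; rewrite -mulrDr; congr (_ * _).
rewrite -IH; [|exact: smooth_dx|exact: smooth_dx].
by congr (jet _ _ _); apply/funext => y; exact: dxD.
Qed.

Lemma jet0 U n : jet U n (fun=> 0) = 0.
Proof.
elim: n => [|n IH] /=; first exact: rmorph0.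
by rewrite big1// => j _; rewrite dx_cst IH mulr0.
Qed.

Lemma jetZ U n (a : R) f : smooth f ->
  jet U n (fun y => a * f y) = c a * jet U n f.
Proof.
elim: n f => [|n IH] f sf /=; first exact: rmorphM.
rewrite mulr_sumr; apply: eq_bigr => j _; rewrite mulrCA -IH; last exact: smooth_dx.
congr (_ * jet _ _ _); apply/funext => y.
by rewrite dxM ?dx_cst ?mulr0 ?addr0//; exact: smooth_cst.
Qed.

Lemma jet_sum U n (I : Type) (r : seq I) (F : I -> phase R d -> R) :
  (forall i, smooth (F i)) ->
  jet U n (fun y => \sum_(i <- r) F i y) = \sum_(i <- r) jet U n (F i).
Proof.
move=> sF; elim: r => [|i r IH].
  by rewrite big_nil -(jet0 U n); congr (jet _ _ _); apply/funext => y; rewrite big_nil.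
rewrite big_cons -IH -jetD//; last exact: smooth_sum.
by congr (jet _ _ _); apply/funext => y; rewrite big_cons.
Qed.

Lemma jetM U n f g : smooth f -> smooth g ->
  jet U n (fun y => f y * g y) =
  \sum_(k < n.+1) (jet U k f * jet U (n - k) g) *+ 'C(n, k).
Proof.
(* One more derivative falls on either factor of the product; Pascal's rule merges the two sums that
   result. *)
have pascal (F : nat -> Q) m :
    \sum_(k < m.+1) F k *+ 'C(m, k) + \sum_(k < m.+1) F k.+1 *+ 'C(m, k) =
    \sum_(k < m.+2) F k *+ 'C(m.+1, k).
  rewrite [RHS]big_ord_recl /= bin0.
  under [in RHS]eq_bigr do rewrite /bump /= add1n binS mulrnDr.
  rewrite big_split /= addrA; congr (_ + _).
  by rewrite big_ord_recl bin0 [in RHS]big_ord_recr /= bin_small// mulr0n addr0.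
elim: n f g => [|n IH] f g sf sg.
  by rewrite big_ord1 /= rmorphM.
rewrite -(pascal (fun k => jet U k f * jet U (n.+1 - k) g)).
have dfg j : dx j (fun y => f y * g y) =
    (fun y => f y * dx j g y + g y * dx j f y).
  by apply/funext => y; exact: dxM.
rewrite [LHS]/=; under eq_bigr => j _.
  rewrite dfg jetD; try by apply: smoothM => //; exact: smooth_dx.
  rewrite (_ : (fun y => g y * dx j f y) = (fun y => dx j f y * g y)); last first.
    by apply/funext => y; rewrite mulrC.
  rewrite !IH//; try exact: smooth_dx.
  rewrite mulrDr !mulr_sumr; over.
rewrite big_split /=; congr (_ + _); rewrite exchange_big /=; apply: eq_bigr => k _.
  rewrite subSn -1?ltnS// /= mulr_sumr -sumrMnl; apply: eq_bigr => j _.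
  by rewrite -!mulrnAr mulrCA.
rewrite subSS mulr_suml -sumrMnl; apply: eq_bigr => j _.
by rewrite -!mulrnAr mulrA.
Qed.

Lemma jet_tuple U n f : smooth f ->
  jet U n f = \sum_(i : n.-tuple 'I_d)
    (\prod_(k < n) U (tnth i k)) * c (dxs i f z).
Proof.
elim: n f => [|n IH] f sf.
  by rewrite (big_pred1 [tuple]) ?big_ord0 ?mul1r// => t; apply/esym/eqP; exact: tuple0.
rewrite big_tuple_cons /=; apply: eq_bigr => j _.
rewrite IH; last exact: smooth_dx.
rewrite mulr_sumr; apply: eq_bigr => t _.
(* [jet] takes the derivative in direction [j] first, [dxs] takes it last; mixed derivatives
   commute. *)
rewrite big_ord_recl mulrA dxs_dx//; congr (_ * _ * _).
by apply: eq_bigr => k _; congr (U _); rewrite !(tnth_nth j).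
Qed.

Lemma jet_xcoord U n i :
  jet U n (xcoord i) = if n is n'.+1 then (if n' is 0 then U i else 0)
                       else c (xcoord i z).
Proof.
case: n => [//|[|n]] /=.
  rewrite (bigD1 i)//= dx_xcoord eqxx rmorph1 mulr1 big1 ?addr0// => j ji.
  by rewrite dx_xcoord eq_sym (negbTE ji) rmorph0 mulr0.
rewrite big1// => j _; rewrite dx_xcoord big1 ?mulr0// => k _.
by rewrite dx_cst jet0 mulr0.
Qed.

(** [D] kills the derivatives of [f] at [z], so it acts on one of the n+1 factors U, and each choice
    contributes the same since mixed derivatives commute. Divided by (n+1)!, this is the chain
    rule. *)
Lemma jet_derivation (D : Q -> Q) U n f :
  {morph D : a b / a + b} -> (forall a b, D (a * b) = D a * b + a * D b) ->
  (forall r, D (c r) = 0) -> smooth f ->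
  D (jet U n.+1 f) = (\sum_(j < d) D (U j) * jet U n (dx j f)) *+ n.+1.
Proof.
move=> DD DM Dc.
have D0 : D 0 = 0.
  by have := DD 0 0; rewrite addr0 => /eqP; rewrite addrC -subr_eq subrr => /eqP.
have Dsum (F : 'I_d -> Q) : D (\sum_j F j) = \sum_j D (F j).
  exact: (big_morph D DD D0).
elim: n f => [|n IH] f sf.
  by rewrite /= Dsum; apply: eq_bigr => j _; rewrite DM Dc mulr0 addr0.
rewrite [jet U n.+2 f]/= -/(jet _ n.+1 _) Dsum.
under eq_bigr => j _.
  rewrite DM -[\sum_(k < d) _]/(jet U n.+1 (dx j f)) IH; last exact: smooth_dx.
  over.
rewrite big_split /= [in RHS]mulrS; congr (_ + _).
under eq_bigr do rewrite mulrnAr mulr_sumr.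
rewrite sumrMnl exchange_big /=; congr (_ *+ _); apply: eq_bigr => k _.
rewrite mulr_sumr; apply: eq_bigr => j _.
by rewrite mulrCA dxC.
Qed.

End Jets.

Lemma jet_morph (R : realType) d (Q Q' : comNzRingType) (c : {rmorphism R -> Q})
    (c' : {rmorphism R -> Q'}) (h : {rmorphism Q -> Q'}) (z : phase R d) U n f :
  (forall r, h (c r) = c' r) ->
  h (jet c z U n f) = jet c' z (fun j => h (U j)) n f.
Proof.
move=> hc; elim: n f => [|n IH] f /=; first exact: hc.
by rewrite rmorph_sum; apply: eq_bigr => j _; rewrite rmorphM IH.
Qed.

Section TruncatedTaylor.
Variables (R : realType) (d : nat) (A : comNzRingType).
Variable c : {rmorphism R -> {poly A}}.
Variables (z : phase R d) (N : nat).
Implicit Types (f g : phase R d -> R) (U : 'I_d -> {poly A}).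

(* [f(x + U, p)] modulo [eps^{N+1}], for [U] divisible by [eps]. *)
Definition taylor U f : {poly A} :=
  \sum_(n < N.+1) c n`!%:R^-1 * jet c z U n f.

(** Each of the n factors U is divisible by eps, so the jet is divisible by eps^n. *)
Lemma coef_jet_lt U n f m : (forall j, (U j)`_0 = 0) -> (m < n)%N ->
  (jet c z U n f)`_m = 0.
Proof.
move=> U0; elim: n m f => [//|n IH] m f mn /=.
rewrite coef_sum big1// => j _; apply: (@coefM_lt _ _ _ 1 n) => //.
  by case=> // _; exact: U0.
by move=> i; exact: IH.
Qed.

Lemma jet_eqmodX h U U' n f : (forall j, eqmodX h (U j) (U' j)) ->
  eqmodX h (jet c z U n f) (jet c z U' n f).
Proof.
move=> UU; elim: n f => [//|n IH] f /=.
by apply: eqmodX_sum => j; apply: eqmodXM.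
Qed.

Lemma taylor_eqmodX h U U' f : (forall j, eqmodX h (U j) (U' j)) ->
  eqmodX h (taylor U f) (taylor U' f).
Proof.
by move=> UU; apply: eqmodX_sum => n; apply: eqmodXM => //; exact: jet_eqmodX.
Qed.

Lemma taylorZ U (a : R) f : smooth f ->
  taylor U (fun y => a * f y) = c a * taylor U f.
Proof.
move=> sf; rewrite /taylor mulr_sumr; apply: eq_bigr => n _.
by rewrite jetZ// mulrCA.
Qed.

Lemma taylor_sum U (I : Type) (r : seq I) (F : I -> phase R d -> R) :
  (forall i, smooth (F i)) ->
  taylor U (fun y => \sum_(i <- r) F i y) = \sum_(i <- r) taylor U (F i).
Proof.
move=> sF; rewrite /taylor exchange_big /=; apply: eq_bigr => n _.
by rewrite jet_sum// mulr_sumr.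
Qed.

Let triangle_sum (G : nat -> nat -> {poly A}) :
  \sum_(n < N.+1) \sum_(k < n.+1) G k (n - k)%N =
  \sum_(k < N.+1) \sum_(l < N.+1 | (k + l <= N)%N) G k l.
Proof.
under eq_bigr => n _.
  rewrite -(big_mkord xpredT (fun k => G k (n - k)%N)).
  rewrite (big_nat_widen _ _ N.+1)//= big_mkord; over.
rewrite (exchange_big_dep xpredT)//=; apply: eq_bigr => k _.
rewrite -(big_mkord (fun l => k + l <= N)%N (fun l => G k l)).
rewrite -(big_mkord (fun n => k < n.+1)%N (fun n => G k (n - k)%N)).
rewrite (big_cat_nat (n := k))//=; last exact: ltnW.
rewrite big_nat_cond big1 ?add0r; last by move=> i; lia.
rewrite -{1}[k : nat]add0n big_addn.
rewrite [RHS](big_cat_nat (n := N.+1 - k))//=; last exact: leq_subr.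
rewrite [X in _ = _ + X]big_nat_cond [X in _ = _ + X]big1 ?addr0; last by move=> i; lia.
rewrite big_nat_cond [RHS]big_nat_cond; apply: eq_big => i; first by lia.
by move=> _; rewrite addnK.
Qed.

(** Only a congruence: besides the terms of the Leibniz formula, the product of two truncations
    contains terms with k + l > N, which are divisible by eps^{k+l}. *)
Lemma taylorM U f g : (forall j, (U j)`_0 = 0) -> smooth f -> smooth g ->
  eqmodX N (taylor U (fun y => f y * g y)) (taylor U f * taylor U g).
Proof.
move=> U0 sf sg m mN.
pose G k l := (c k`!%:R^-1 * jet c z U k f) * (c l`!%:R^-1 * jet c z U l g).
have -> : taylor U (fun y => f y * g y) =
    \sum_(n < N.+1) \sum_(k < n.+1) G k (n - k)%N.
  apply: eq_bigr => n _; rewrite jetM// mulr_sumr; apply: eq_bigr => k _.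
  rewrite /G [RHS]mulrACA -rmorphM /= -[X in _ * X]mulr_natl (mulrA (c _)); congr (_ * _).
  rewrite -(rmorph_nat c) -rmorphM /=; congr (c _).
  have kn : (k <= n)%N by rewrite -ltnS.
  rewrite -(bin_fact kn) !natrM !invfM.
  by rewrite mulrAC mulVf ?mul1r// pnatr_eq0 -lt0n bin_gt0.
rewrite triangle_sum /taylor big_distrlr /= !coef_sum.
apply: eq_bigr => k _; rewrite !coef_sum [RHS](bigID (fun l : 'I_N.+1 => k + l <= N)%N) /=.
rewrite [X in _ + X]big1 ?addr0// => l; rewrite -ltnNge => Nkl.
apply: (@coefM_lt _ _ _ k l); last by rewrite (leq_ltn_trans mN).
  move=> i ik; apply: (@coefM_lt _ _ _ 0 k) => // j; exact: coef_jet_lt.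
move=> i ik; apply: (@coefM_lt _ _ _ 0 l) => // j; exact: coef_jet_lt.
Qed.

(** For N = 0 the truncation would lose the linear term. *)
Lemma taylor_xcoord U i : (0 < N)%N -> taylor U (xcoord i) = c (xcoord i z) + U i.
Proof.
move=> N0; rewrite /taylor; case: N N0 => // n _.
rewrite 2!big_ord_recl big1 ?addr0; last by move=> k _; rewrite jet_xcoord mulr0.
by rewrite !jet_xcoord /bump /= invr1 rmorph1 !mul1r.
Qed.

End TruncatedTaylor.

(** * The flow equation and formal composition *)

Section VectorField.
Variables (R : realType) (d : nat) (P : 'rV[R]_d -> 'M[R]_d).
Hypothesis sP : forall i j, smooth (fun x => P x i j).
Implicit Types (f : phase R d -> R).

Lemma smooth_Vbar j : smooth (Vbar P j).
Proof.
apply/smoothN/smooth_sum => i; apply: smoothM; last exact: smooth_pcoord.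
by move=> k; exact: (Ck_comp_fst _ (@sP i j k)).
Qed.

Lemma smooth_LVbar f : smooth f -> smooth (LVbar P f).
Proof.
move=> sf; apply: smooth_sum => j; apply: smoothM; first exact: smooth_Vbar.
exact: smooth_dx.
Qed.

Lemma smooth_iter_LVbar m f : smooth f -> smooth (iter m (LVbar P) f).
Proof. by move=> sf; elim: m => //= m; exact: smooth_LVbar. Qed.

End VectorField.

Section Flow.
Variables (R : realType) (d : nat) (P : 'rV[R]_d -> 'M[R]_d).
Hypothesis sP : forall i j, smooth (fun x => P x i j).
Variables (z : phase R d) (N : nat) (U : 'I_d -> {poly {poly R}}).

(* Series in [eps] (outer variable) with coefficients polynomial in [theta]. *)
Definition const2 : {rmorphism R -> {poly {poly R}}} :=
  (@polyC {poly R} \o @polyC R).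

Definition dtheta (a : {poly {poly R}}) : {poly {poly R}} := map_poly (@deriv R) a.

Local Notation T := (taylor const2 z N U).

(** The curve u(theta) = x + U(theta) reduces to x at eps = 0, solves u' = eps V(u) modulo eps^{N+1}
    and has mean x over [0, 1]. *)
Hypothesis U0 : forall j, (U j)`_0 = 0.
Hypothesis dU : forall j, eqmodX N (dtheta (U j)) ('X * T (Vbar P j)).
Hypothesis intU : forall j k, int01 (U j)`_k = 0.

Lemma coef_dtheta a k : (dtheta a)`_k = (a`_k)^`().
Proof. exact: coef_map. Qed.

Lemma dthetaD : {morph dtheta : a b / a + b}.
Proof. by move=> a b; apply/polyP => k; rewrite !(coef_dtheta, coefD) derivD. Qed.

Lemma dthetaM a b : dtheta (a * b) = dtheta a * b + a * dtheta b.
Proof.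
apply/polyP => k; rewrite coef_dtheta coefD !coefM raddf_sum -big_split /=.
by apply: eq_bigr => i _; rewrite derivM !coef_dtheta.
Qed.

Lemma dtheta_const2 r : dtheta (const2 r) = 0.
Proof.
by apply/polyP => k; rewrite coef_dtheta coefC; case: k => [|k]; rewrite ?derivC ?deriv0 coef0.
Qed.

Lemma dtheta_taylor f : smooth f -> eqmodX N (dtheta (T f)) ('X * T (LVbar P f)).
Proof.
move=> sf.
have D0 : dtheta 0 = 0 by apply/polyP => k; rewrite coef_dtheta !coef0 deriv0.
pose S j n := const2 n`!%:R^-1 * jet const2 z U n (dx j f).
have -> : dtheta (T f) = \sum_(j < d) dtheta (U j) * \sum_(n < N) S j n.
  rewrite (big_morph _ dthetaD D0) big_ord_recl dthetaM dtheta_const2 mul0r add0r.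
  rewrite dtheta_const2 mulr0 add0r.
  under eq_bigr => n _.
    rewrite dthetaM dtheta_const2 mul0r add0r lift0.
    rewrite (@jet_derivation _ _ _ const2 z dtheta U n f dthetaD dthetaM
      dtheta_const2 sf).
    rewrite mulrnAr -mulrnAl -rmorphMn /= -(mulr_natr _^-1) factS natrM invfM mulrAC.
    rewrite mulVf ?mul1r ?pnatr_eq0// mulr_sumr; over.
  rewrite exchange_big /=; apply: eq_bigr => j _; rewrite mulr_sumr.
  by apply: eq_bigr => n _; rewrite mulrCA.
apply: (@eqmodX_trans _ _ _ (\sum_(j < d) ('X * T (Vbar P j)) * T (dx j f))).
  apply: eqmodX_sum => j; apply: eqmodX_trans (eqmodXM (dU j) (eqmodX_refl _)).
  (* Differentiation yields the jets of [dx j f] only up to order N - 1. The missing one is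
     divisible by eps^N, and its factor [dtheta (U j)] by eps. *)
  move=> m mN; rewrite /taylor big_ord_recr /= mulrDr coefD.
  rewrite [X in _ + X](@coefM_lt _ _ _ 1 N) ?addr0//.
    by case=> // _; rewrite coef_dtheta U0 deriv0.
  move=> i iN; apply: (@coefM_lt _ _ _ 0 N) => // k; exact: coef_jet_lt.
have -> : T (LVbar P f) = \sum_(j < d) T (fun y => Vbar P j y * dx j f y).
  rewrite /LVbar taylor_sum// => j; apply: smoothM; last exact: smooth_dx.
  exact: smooth_Vbar.
rewrite mulr_sumr; apply: eqmodX_sum => j m mN.
rewrite -mulrA; case: m mN => [|m] mN; rewrite !coefXM//=.
by rewrite taylorM ?(ltnW mN)//; [exact: smooth_Vbar|exact: smooth_dx].
Qed.

(** By the chain rule every theta-derivative costs one power of eps and applies L_V once, so the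
    coefficient of eps^n has degree at most n in theta. *)
Lemma derivn_taylor n m f : smooth f -> (n <= N)%N ->
  ((T f)`_n)^`(m) = if (m <= n)%N then (T (iter m (LVbar P) f))`_(n - m) else 0.
Proof.
elim: m n f => [|m IH] n f sf nN; first by rewrite subn0.
rewrite derivSn -coef_dtheta dtheta_taylor// coefXM.
case: n nN => [|n] nN /=; first by rewrite linear0.
by rewrite IH ?(ltnW nN)//; [rewrite -iterSr|exact: smooth_LVbar].
Qed.

(** For f = x^i the right side is the coefficient of eps^n in phi_eps(u(0), p), the left side that
    of the mean of u^i. *)
Lemma int01_taylor_flow n f : smooth f -> (n <= N)%N ->
  int01 (T f)`_n =
  \sum_(m < n.+1) (m.+1)`!%:R^-1 * ((T (iter m (LVbar P) f))`_(n - m)).[0].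
Proof.
move=> sf nN; pose K := maxn n.+1 (size (T f)`_n).
rewrite (@int01_taylor _ _ K); last exact: leq_maxr.
rewrite -(big_mkord xpredT (fun m => ((T f)`_n)^`(m).[0] / (m.+1)`!%:R)).
rewrite (big_cat_nat (n := n.+1))//=; last exact: leq_maxl.
rewrite big_mkord [X in _ + X]big_nat_cond [X in _ + X]big1 ?addr0.
  by apply: eq_bigr => m _; rewrite derivn_taylor// -ltnS ltn_ord mulrC.
by move=> m /andP[/andP[nm _] _]; rewrite derivn_taylor// leqNgt nm horner0 mul0r.
Qed.

Lemma int01_taylor_xcoord n i : (0 < N)%N ->
  int01 (T (xcoord i))`_n = xseries i n z.
Proof.
move=> N0; rewrite taylor_xcoord// coefD linearD /= intU addr0 coefC /xseries.
by case: ifP; rewrite ?int01C ?linear0.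
Qed.

End Flow.

(** * Formal composition as a Taylor polynomial *)

Section FormalComposition.
Variables (R : realType) (d : nat) (z : phase R d) (alpha : 'I_d -> fseries R d).
Hypothesis alpha0 : forall i, alpha i 0%N z = xcoord i z.

Let row_alpha : (\row_j alpha j 0%N z, z.2) = z.
Proof.
rewrite [RHS]surjective_pairing; congr pair.
by apply/rowP => j; rewrite mxE alpha0.
Qed.

Lemma fprod_coef n (a : 'I_n -> fseries R d) (W : 'I_n -> {poly R}) K m :
  (forall k i, (i <= K)%N -> a k i z = (W k)`_i) -> (m <= K)%N ->
  (\big[@fmul R d/@fone R d]_(k < n) a k) m z = (\prod_(k < n) W k)`_m.
Proof.
move=> aW; elim: n a W aW m => [|n IH] a W aW m mK.
  by rewrite !big_ord0 /fone coef1.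
rewrite !big_ord_recl /fmul coefM; apply: eq_bigr => k _.
rewrite aW; last by rewrite (leq_trans _ mK)// -ltnS.
rewrite (IH _ (fun k => W (lift ord0 k)))//; last by rewrite (leq_trans _ mK)// leq_subr.
by move=> j i iK; rewrite aW.
Qed.

(** [fcomp_fun] takes eps^n out of the n displacements, whereas [taylor] leaves it inside U; the
    proof passes between them by U = W 'X. *)
Lemma fcomp_fun_taylor N (U : 'I_d -> {poly R}) f M :
  (forall j, (U j)`_0 = 0) ->
  (forall j k, (0 < k <= N)%N -> (U j)`_k = alpha j k z) ->
  smooth f -> (M <= N)%N ->
  fcomp_fun f alpha M z = (taylor (@polyC R) z N U f)`_M.
Proof.
move=> U0 UA sf MN.
pose W j : {poly R} := \poly_(k < size (U j)) (U j)`_k.+1.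
have UW j : U j = W j * 'X.
  apply/polyP => -[|k]; rewrite coefMX//= coef_poly; case: ltnP => // Uk.
  by rewrite nth_default// ltnW.
rewrite /fcomp_fun /fsum /taylor coef_sum.
rewrite -(big_mkord xpredT (fun n => (n`!%:R^-1 * \sum_(i : n.-tuple 'I_d)
  (\big[@fmul R d/@fone R d]_(k < n) (fun n => alpha (tnth i k) n.+1)) (M - n)%N z
    * dxs i f (\row_j alpha j 0%N z, z.2)))).
rewrite (big_nat_widen _ _ N.+1)//= big_mkord big_mkcond /=.
apply: eq_bigr => n _; rewrite coefCM jet_tuple// coef_sum row_alpha.
case: ifP => [nM|/negbT]; last first.
  rewrite -leqNgt => Mn; rewrite big1 ?mulr0// => i _.
  rewrite coefMC; under eq_bigr do rewrite UW.
  by rewrite big_split /= prodr_const card_ord coefMXn Mn mul0r.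
congr (_ * _); apply: eq_bigr => i _; rewrite coefMC; congr (_ * _).
under [in RHS]eq_bigr do rewrite UW.
rewrite big_split /= prodr_const card_ord coefMXn ltnNge -ltnS nM /=.
(* The coefficients of [W] up to M - n are those of [alpha] up to M - n + 1, which is at most N only
   for n > 0; for n = 0 the product is empty. *)
case: (n : nat) i nM => [|n'] i nM; first by rewrite !big_ord0 /fone coef1.
apply: (@fprod_coef _ _ _ (M - n'.+1)) => // k m mM.
rewrite -[LHS]UA; last by lia.
by rewrite UW coefMX.
Qed.

End FormalComposition.

(** * Plane trees and the fixed point equation *)

Local Notation leaf := (Node [::]).

Section Words.
Variable T : eqType.
Implicit Types (L w : seq T).

Fixpoint words L m : seq (seq T) :=
  if m is m'.+1 then [seq a :: w | a <- L, w <- words L m'] else [:: [::]].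

Lemma mem_words L m w : (w \in words L m) = (size w == m) && all [in L] w.
Proof.
elim: m w => [|m IH] [|a w] //=.
  by apply/allpairsP => -[[? ?] [? ? //]].
rewrite eqSS andbCA -IH; apply/allpairsP/andP => [[[b v] [/= bL vw [-> ->]]]|[aL wm]].
  by [].
by exists (a, w).
Qed.

Lemma size_words L m w : w \in words L m -> size w = m.
Proof. by rewrite mem_words => /andP[/eqP]. Qed.

Lemma prod_sum_words (Q : comNzRingType) L (x0 : T) m (g : 'I_m -> T -> Q) :
  \prod_(k < m) \sum_(a <- L) g k a =
  \sum_(w <- words L m) \prod_(k < m) g k (nth x0 w k).
Proof.
elim: m g => [|m IH] g; first by rewrite big_ord0 big_seq1 big_ord0.
rewrite big_ord_recl /= big_allpairs_dep mulr_suml; apply: eq_bigr => a _.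
rewrite (IH (fun k => g (lift ord0 k))) mulr_sumr; apply: eq_bigr => w _.
by rewrite big_ord_recl.
Qed.

End Words.

Lemma mem_vertices ts u : u \in vertices (Node ts) =
  if u is k :: v then (k < size ts)%N && (v \in vertices (nth leaf ts k)) else true.
Proof.
case: u => [|k v] //=; rewrite in_cons /=.
apply/flattenP/andP => [[s /mapP[j]]|[kts vk]].
  rewrite mem_iota /= add0n => jts -> /mapP[w].
  by rewrite (nth_map leaf)// => wj [-> ->].
exists [seq k :: v0 | v0 <- nth [::] (map vertices ts) k].
  by apply/mapP; exists k => //; rewrite mem_iota.
by rewrite (nth_map leaf)//; apply/mapP; exists v.
Qed.

Lemma size_vertices ts :
  size (vertices (Node ts)) = (\sum_(t <- ts) size (vertices t)).+1.
Proof.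
rewrite /= size_flatten /shape -map_comp sumnE big_map -[X in iota 0 X]subn0 -/(index_iota 0 _).
rewrite (big_nth leaf) big_nat [in RHS]big_nat; congr _.+1; apply: eq_bigr => k /andP[_ kts] /=.
by rewrite size_map (nth_map leaf).
Qed.

Lemma uniq_vertices t : uniq (vertices t).
Proof.
elim/ptree_nth_ind: t => ts IH /=; apply/andP; split.
  by apply/flattenP => -[s /mapP[j _ ->] /mapP[]].
apply: (@allpairs_uniq_dep _ _ _ (fun k v => k :: v) (iota 0 (size ts))
   (fun k => nth [::] (map vertices ts) k)).
- exact: iota_uniq.
- by move=> k; rewrite mem_iota /= => kts; rewrite (nth_map leaf)// IH.
- by move=> [k v] [k' v'] _ _ /= [-> ->].
Qed.

Lemma torderE t : torder t = size (vertices t).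
Proof. by rewrite /torder card_seq_sub// uniq_vertices. Qed.

Lemma torder_Node ts : torder (Node ts) = (\sum_(t <- ts) torder t).+1.
Proof.
by rewrite torderE size_vertices; congr _.+1; apply: eq_bigr => t _; rewrite torderE.
Qed.

Lemma torder_gt0 t : (0 < torder t)%N.
Proof. by case: t => ts; rewrite torder_Node. Qed.

(* The plane trees of height at most [h] with at most [N] branches at each
   vertex. *)
Fixpoint plane_trees (N h : nat) : seq ptree :=
  if h is h'.+1 then
    [seq Node w | w <- flatten [seq words (plane_trees N h') m | m <- iota 0 N.+1]]
  else [::].

Lemma big_plane_trees (A : nmodType) N h (F : ptree -> A) :
  \sum_(t <- plane_trees N h.+1) F t =
  \sum_(m < N.+1) \sum_(w <- words (plane_trees N h) m) F (Node w).
Proof.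
rewrite -[plane_trees N h.+1]/[seq Node w | w <- flatten
  [seq words (plane_trees N h) m | m <- iota 0 N.+1]].
by rewrite big_map big_flatten big_map -[X in iota 0 X]subn0 -/(index_iota 0 _) big_mkord.
Qed.

(** A tree with n vertices has at most n levels, and each vertex has at most n - 1 branches. *)
Lemma mem_plane_trees N h t : (torder t <= h)%N -> (torder t <= N.+1)%N ->
  t \in plane_trees N h.
Proof.
elim: h t => [|h IH] [ts]; first by rewrite leqn0 -[_ == 0%N]negbK -lt0n torder_gt0.
rewrite torder_Node !ltnS => th tN; apply: map_f; apply/flattenP.
have tle t : t \in ts -> (torder t <= \sum_(t <- ts) torder t)%N.
  by move=> tts; rewrite (big_rem t)//= leq_addr.
exists (words (plane_trees N h) (size ts)).
  apply/map_f; rewrite mem_iota /= add0n ltnS (leq_trans _ tN)//.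
  by rewrite -sum1_size; apply: leq_sum => t _; exact: torder_gt0.
rewrite mem_words eqxx; apply/allP => t /tle tt.
apply: IH; first exact: leq_trans th.
by rewrite (leq_trans tt)// (leq_trans tN).
Qed.

Section PlaneCoef.
Variable R : realType.

(* The weight of a single plane tree: those of the plane trees isomorphic to
   [t] add up to [1 / sigma t]. *)
Fixpoint plane_coef (t : ptree) : R :=
  let: Node ts := t in (size ts)`!%:R^-1 * \prod_(x <- map plane_coef ts) x.

(** The length is a variable tied by an equation, so that the lists in [words L m] are indexed by
    'I_m without a cast; likewise in the similar lemmas below. *)
Lemma plane_coef_Node ts m : size ts = m ->
  plane_coef (Node ts) = m`!%:R^-1 * \prod_(k < m) plane_coef (nth leaf ts k).
Proof. by move=> <-; rewrite /= big_map (big_nth leaf) big_mkord. Qed.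

Lemma weight_poly_Node ts m : size ts = m ->
  weight_poly R (Node ts) =
  weight_integral (\prod_(k < m) weight_poly R (nth leaf ts k)).
Proof. by move=> <-; rewrite /= big_map (big_nth leaf) big_mkord. Qed.

End PlaneCoef.

Lemma torder_Node_nth ts m : size ts = m ->
  torder (Node ts) = (\sum_(k < m) torder (nth leaf ts k)).+1.
Proof. by move=> <-; rewrite torder_Node (big_nth leaf) big_mkord. Qed.

Section Monomials.
Variable R : realType.

Definition mono (r : R) (p : {poly R}) e : {poly {poly R}} := (r *: p)%:P * 'X^e.

Lemma const2_mono a r p e : const2 R a * mono r p e = mono (a * r) p e.
Proof.
by rewrite -[const2 R a]/(a%:P%:P) /mono mulrA -polyCM (mul_polyC a) scalerA.
Qed.

Lemma mono_sum (I : Type) (s : seq I) (r : I -> R) p e :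
  \sum_(i <- s) mono (r i) p e = mono (\sum_(i <- s) r i) p e.
Proof. by rewrite /mono scaler_suml rmorph_sum mulr_suml. Qed.

Lemma mono_prod m (r : 'I_m -> R) p e :
  \prod_(k < m) mono (r k) (p k) (e k) =
  mono (\prod_(k < m) r k) (\prod_(k < m) p k) (\sum_(k < m) e k).
Proof.
rewrite /mono big_split /= -rmorph_prod /= scaler_prod; congr (_ * _).
by rewrite expr_sum.
Qed.

End Monomials.

(** * Picard iterates as sums over plane trees *)

Section BSeries.
Variables (R : realType) (d : nat) (X : 'I_d -> phase R d -> R).
Hypothesis sX : forall i, smooth (X i).
Variable z : phase R d.

Lemma elementary_differential_Node ts m u : size ts = m ->
  elementary_differential X (Node ts) u =
  fun z => \sum_(i : m.-tuple 'I_d) dxs i (X u) z *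
    \prod_(k < m) elementary_differential X (nth leaf ts k) (tnth i k) z.
Proof.
move=> <-; apply/funext => y /=; apply: eq_bigr => i _; congr (_ * _).
by apply: eq_bigr => k _; rewrite (nth_map leaf).
Qed.

Lemma smooth_elementary_differential t u : smooth (elementary_differential X t u).
Proof.
elim/ptree_nth_ind: t u => ts IH u; rewrite (elementary_differential_Node _ (erefl _)).
apply: smooth_sum => i; apply: smoothM; first exact: smooth_dxs.
by apply: smooth_prod => k; exact: IH.
Qed.

Definition bcoef (i : 'I_d) (t : ptree) : R :=
  plane_coef R t * (-1) ^+ torder t * elementary_differential X t i z.

Definition bterm (i : 'I_d) (t : ptree) : {poly {poly R}} :=
  mono (bcoef i t) (weight_poly R t) (torder t).

(** The h-th Picard iterate from U = 0. Truncating Taylor expansions at order [N] bounds the number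
    of branches by [N]. *)
Definition bseries N h i := \sum_(t <- plane_trees N h) bterm i t.

Lemma coef0_bseries N h i : (bseries N h i)`_0 = 0.
Proof.
by rewrite coef_sum big1// => t _; rewrite coefCM coefXn eq_sym gtn_eqF ?mulr0// torder_gt0.
Qed.

Lemma coef_bseries N h i k :
  (bseries N h i)`_k =
  \sum_(t <- plane_trees N h | torder t == k) bcoef i t *: weight_poly R t.
Proof.
rewrite coef_sum [RHS]big_mkcond; apply: eq_bigr => t _.
by rewrite coefCM coefXn eq_sym; case: eqP; rewrite (mulr1, mulr0).
Qed.

Definition picard_step (a : {poly {poly R}}) : {poly {poly R}} :=
  - ('X * map_poly (@weight_integral R) a).

Lemma coef_picard_step a k :
  (picard_step a)`_k = if k is k'.+1 then - weight_integral a`_k' else 0.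
Proof. by rewrite coefN coefXM; case: k => [|k] /=; rewrite ?oppr0// coef_map. Qed.

(** Expanding the m-th jet picks a list of m branches. The Taylor factor 1/m! enters [plane_coef],
    and [picard_step] adds the root: its integral, its sign and its power of eps. With matching
    truncations the equality is exact. *)
Lemma bseriesS N h i :
  bseries N h.+1 i = picard_step (taylor (const2 R) z N (bseries N h) (X i)).
Proof.
have pD : {morph picard_step : a b / a + b}.
  move=> a b; apply/polyP => -[|k]; rewrite !(coef_picard_step, coefD) ?addr0//.
  by rewrite -opprD -raddfD.
have p0 : picard_step 0 = 0.
  by apply/polyP => -[|k]; rewrite !(coef_picard_step, coef0)// linear0 oppr0.
rewrite /bseries big_plane_trees /taylor (big_morph _ pD p0).
apply: eq_bigr => m _.
have -> : const2 R m`!%:R^-1 * jet (const2 R) z (bseries N h) m (X i) =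
    \sum_(w <- words (plane_trees N h) m)
      mono (- bcoef i (Node w)) (\prod_(k < m) weight_poly R (nth leaf w k))
        (\sum_(k < m) torder (nth leaf w k)).
  rewrite jet_tuple//.
  under eq_bigr do rewrite (prod_sum_words _ leaf) mulr_suml.
  rewrite exchange_big /= mulr_sumr; apply: eq_big_seq => w /size_words sw.
  rewrite mulr_sumr /bterm.
  under [LHS]eq_bigr do rewrite mono_prod -/(const2 R _) mulrCA mulrC -mulrA !const2_mono.
  rewrite mono_sum /bcoef (plane_coef_Node R sw) (torder_Node_nth sw).
  rewrite (elementary_differential_Node i sw); congr mono.
  (* The root's factor -1 in [bcoef] cancels the outer sign, which [picard_step] restores. *)
  rewrite exprS mulN1r mulrN mulNr opprK mulr_sumr; apply: eq_bigr => j _.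
  rewrite !big_split /= -expr_sum; ring.
rewrite (big_morph _ pD p0); apply: eq_big_seq => w /size_words sw.
rewrite /bterm /mono (torder_Node_nth sw) (weight_poly_Node R sw).
apply/polyP => -[|k]; rewrite coef_picard_step !coefCM !coefXn ?mulr0// eqSS.
by case: eqP; rewrite ?mulr0 ?mulr1 ?linear0 ?oppr0// linearZ /= scaleNr opprK.
Qed.

(** The factor eps in [picard_step] makes it a contraction: each iteration fixes one more
    coefficient. *)
Lemma bseries_eqmodX N h i : eqmodX h (bseries N h i) (bseries N h.+1 i).
Proof.
elim: h i => [|h IH] i; first by case=> // _; rewrite !coef0_bseries.
move=> [|k] kh; first by rewrite !coef0_bseries.
rewrite [in LHS]bseriesS [in RHS]bseriesS !coef_picard_step; congr (- weight_integral _).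
exact: (@taylor_eqmodX _ _ _ (const2 R) z N h _ _ (X i) IH k kh).
Qed.

End BSeries.

(** * Isomorphisms of plane trees *)

Lemma graft_subproof ts (k : 'I_(size ts)) (v : vertex (nth leaf ts k)) :
  (k : nat) :: val v \in vertices (Node ts).
Proof. by rewrite mem_vertices ltn_ord; exact: valP v. Qed.

Definition graft ts (k : 'I_(size ts)) (v : vertex (nth leaf ts k)) :
  vertex (Node ts) := SeqSub (graft_subproof v).

Lemma graft_inj1 ts (k k' : 'I_(size ts))
    (v : vertex (nth leaf ts k)) (v' : vertex (nth leaf ts k')) :
  graft v = graft v' -> k = k'.
Proof. by move=> /(congr1 val)[kk _]; exact: val_inj. Qed.

Lemma graft_inj2 ts (k : 'I_(size ts)) : injective (@graft ts k).
Proof. by move=> v v' /(congr1 val)[vv]; exact: val_inj. Qed.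

Lemma vertex_Node ts (u : vertex (Node ts)) :
  u = troot (Node ts) \/ exists (k : 'I_(size ts)) (v : vertex (nth leaf ts k)), u = graft v.
Proof.
case: u => -[|k v] ku; first by left; exact: val_inj.
right; have := ku; rewrite mem_vertices => /andP[kts vk].
by exists (Ordinal kts), (SeqSub vk); exact: val_inj.
Qed.

Lemma graft_neq_root ts (k : 'I_(size ts)) (v : vertex (nth leaf ts k)) :
  graft v <> troot (Node ts).
Proof. by move=> /(congr1 val). Qed.

Lemma not_child_root t (u : vertex t) : ~ is_child u (troot t).
Proof. by move=> [k] /=; case: (val u). Qed.

Lemma child_root_graft ts (k : 'I_(size ts)) (v : vertex (nth leaf ts k)) :
  is_child (troot (Node ts)) (graft v) <-> v = troot _.
Proof.
split=> [[j [_ v0]]|->]; last by exists (k : nat).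
by apply: val_inj; exact: v0.
Qed.

Lemma child_graft_root ts (k : 'I_(size ts)) (v : vertex (nth leaf ts k)) :
  ~ is_child (graft v) (troot (Node ts)).
Proof. exact: not_child_root. Qed.

Lemma child_graft ts (k : 'I_(size ts)) (v w : vertex (nth leaf ts k)) :
  is_child (graft v) (graft w) <-> is_child v w.
Proof.
split=> -[j] /=; first by move=> [wE]; exists j.
by move=> wE; exists j; rewrite /= wE.
Qed.

Lemma child_graft_eq ts (k k' : 'I_(size ts))
    (v : vertex (nth leaf ts k)) (w : vertex (nth leaf ts k')) :
  is_child (graft v) (graft w) -> k = k'.
Proof. by move=> [j /= [kk _]]; exact: val_inj. Qed.

Lemma prefix_vertices t v j : rcons v j \in vertices t -> v \in vertices t.
Proof.
elim: v t => [|k v IH] [ts]; first by rewrite !mem_vertices.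
by rewrite rcons_cons !mem_vertices => /andP[-> /IH].
Qed.

Lemma vertex_ind t (Q : vertex t -> Prop) : Q (troot t) ->
  (forall u v, is_child u v -> Q u -> Q v) -> forall v, Q v.
Proof.
move=> Q0 QS [v vt]; elim/last_ind: v vt => [|v j IH] vt.
  by rewrite (_ : SeqSub vt = troot t)//; exact: val_inj.
by apply: (QS (SeqSub (prefix_vertices vt))) => //; exists j.
Qed.

Lemma is_iso_inv t r (f : vertex t -> vertex r) g :
  cancel f g -> cancel g f -> is_iso f -> is_iso g.
Proof.
move=> fK gK [_ fr fc]; split; first by exists f.
- by rewrite -fr fK.
- by move=> u v; rewrite -{1}(gK u) -{1}(gK v); split=> [/fc|?] //; apply/fc.
Qed.

Lemma is_iso_comp t1 t2 t3 (f : vertex t1 -> vertex t2) (g : vertex t2 -> vertex t3) :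
  is_iso f -> is_iso g -> is_iso (g \o f).
Proof.
move=> [fb fr fc] [gb gr gc]; split; first exact: bij_comp.
- by rewrite /= fr.
- by move=> u v; split=> [/fc/gc|/gc/fc].
Qed.

(** Children of the root go to children of the root, and below them the child relation never leaves
    a branch. *)
Lemma is_iso_graft ts rs (f : vertex (Node ts) -> vertex (Node rs)) : is_iso f ->
  exists s : 'I_(size ts) -> 'I_(size rs), forall (k : 'I_(size ts)) (v : vertex (nth leaf ts k)),
  exists w : vertex (nth leaf rs (s k)), f (graft v) = graft w.
Proof.
move=> [fb fr fc].
have fg (k : 'I_(size ts)) : exists k' : 'I_(size rs),
    f (graft (troot (nth leaf ts k))) = graft (troot (nth leaf rs k')).
  have /fc : is_child (troot (Node ts)) (graft (troot (nth leaf ts k))).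
    exact/child_root_graft.
  rewrite fr; case: (vertex_Node (f (graft (troot (nth leaf ts k))))) => [->|[k' [v ->]]].
    by move/not_child_root.
  by move/child_root_graft => ->; exists k'.
have [s sP] := choice fg; exists s => k; apply: vertex_ind; first by exists (troot _).
move=> u v uv [w fu]; have /fc := (child_graft u v).2 uv; rewrite fu.
case: (vertex_Node (f (graft v))) => [->|[k' [v' ->]]]; first by move/child_graft_root.
move=> c; have sk := child_graft_eq c.
by move: v' c; rewrite -sk => v' _; exists v'.
Qed.

Section IsoNode.
Variables (ts rs : seq ptree).

Definition branch_iso (f : vertex (Node ts) -> vertex (Node rs))
    (s : 'I_(size ts) -> 'I_(size rs))
    (F : forall k : 'I_(size ts), vertex (nth leaf ts k) -> vertex (nth leaf rs (s k))) :=
  forall (k : 'I_(size ts)) (v : vertex (nth leaf ts k)), f (graft v) = graft (F k v).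

(** The branch map of the inverse isomorphism inverts [s], so it leads each branch [s k] back to
    [k], which makes [F k] surjective. *)
Lemma is_iso_branches f : is_iso f -> exists s F,
  [/\ bijective s, forall k, is_iso (F k) & @branch_iso f s F].
Proof.
move=> fi; have [s sP] := is_iso_graft fi.
have [F FP] : exists F, @branch_iso f s F.
  by exists (fun k v => projT1 (cid (sP k v))) => k v; exact: (projT2 (cid (sP k v))).
exists s, F.
have [fb fr fc] := fi; have [g fK gK] := fb.
have [s' s'P] := is_iso_graft (is_iso_inv fK gK fi).
have sK : cancel s s'.
  move=> k; have [w] := s'P _ (F k (troot _)).
  by rewrite -FP fK => /graft_inj1.
have s'K : cancel s' s.
  move=> k; have [w gw] := s'P k (troot _).
  have [v] := sP _ w; rewrite -gw gK => /graft_inj1 //.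
split=> //; first by exists s'.
move=> k; split.
- have FI : injective (F k).
    move=> v w vw; apply: (@graft_inj2 ts); apply: (bij_inj fb).
    by rewrite !FP vw.
  have FS w : exists v, F k v = w.
    have [v gv] := s'P _ w; move: v gv; rewrite sK => v gv.
    by exists v; apply: (@graft_inj2 rs); rewrite -FP -gv gK.
  exists (fun w => projT1 (cid (FS w))) => [v|w].
    by apply: FI; exact: (projT2 (cid (FS (F k v)))).
  exact: (projT2 (cid (FS w))).
- have /fc : is_child (troot (Node ts)) (graft (troot (nth leaf ts k))).
    exact/child_root_graft.
  by rewrite fr FP => /child_root_graft.
- move=> u v; split.
    by move=> /child_graft/fc; rewrite !FP => /child_graft.
  by move=> /child_graft; rewrite -!FP => /fc/child_graft.
Qed.

Lemma branch_iso_is_iso s F : bijective s -> (forall k, is_iso (F k)) ->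
  exists2 f, is_iso f & @branch_iso f s F.
Proof.
move=> sb Fi.
(* [vertex_Node] is a disjunction in Prop, so [f] is obtained by choice from its graph. *)
pose code (u : vertex (Node ts)) (w : vertex (Node rs)) :=
  (u = troot _ -> w = troot _) /\
  (forall (k : 'I_(size ts)) (v : vertex (nth leaf ts k)), u = graft v -> w = graft (F k v)).
have ex_code u : exists w, code u w.
  case: (vertex_Node u) => [->|[k [v ->]]].
    exists (troot _); split=> // k v uv; have := graft_neq_root (esym uv); done.
  exists (graft (F k v)); split; first by move/graft_neq_root.
  move=> k' v' vv; have kk := graft_inj1 vv; move: v' vv; rewrite -kk => v'.
  by move=> /graft_inj2 ->.
have [f fP] := choice ex_code.
have fr : f (troot _) = troot _ by exact: (fP _).1.
have fF : branch_iso f F by move=> k v; exact: (fP _).2.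
exists f => //; split=> //.
- have fI : injective f.
    move=> u u'; case: (vertex_Node u) => [->|[k [v ->]]];
      case: (vertex_Node u') => [->|[k' [v' ->]]] //.
    + by rewrite fr fF => /esym/graft_neq_root.
    + by rewrite fr fF => /graft_neq_root.
    rewrite !fF => vv; have /(bij_inj sb) kk := graft_inj1 vv.
    move: v' vv; rewrite -kk => v' /graft_inj2.
    by have [/bij_inj FI _ _] := Fi k; move/FI ->.
  have fS w : exists u, f u = w.
    case: (vertex_Node w) => [->|[k [v ->]]]; first by exists (troot _).
    have [s' sK s'K] := sb; move: v; rewrite -(s'K k) => v.
    have [[F' FK F'K] _ _] := Fi (s' k).
    by exists (graft (F' v)); rewrite fF F'K.
  exists (fun w => projT1 (cid (fS w))) => [v|w].
    by apply: fI; exact: (projT2 (cid (fS (f v)))).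
  exact: (projT2 (cid (fS w))).
- move=> u u'; case: (vertex_Node u') => [->|[k' [v' ->]]].
    by rewrite fr; split=> /not_child_root.
  case: (vertex_Node u) => [->|[k [v ->]]].
    have [/bij_inj FI Fr _] := Fi k'.
    rewrite fr fF !child_root_graft; split=> [->//|].
    by rewrite -Fr => /FI.
  rewrite !fF; split=> c.
    have kk := child_graft_eq c; move: v' c; rewrite -kk => v' /child_graft c.
    by apply/child_graft; have [_ _ Fc] := Fi k; apply/Fc.
  have /(bij_inj sb) kk := child_graft_eq c.
  move: v' c; rewrite -kk => v' /child_graft c.
  by apply/child_graft; have [_ _ Fc] := Fi k; apply/Fc.
Qed.

Lemma branch_iso_eq f f' s F : is_iso f -> is_iso f' ->
  @branch_iso f s F -> @branch_iso f' s F -> f =1 f'.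
Proof.
move=> [_ fr _] [_ fr' _] fF fF' u.
by case: (vertex_Node u) => [->|[k [v ->]]]; rewrite ?fr ?fr' ?fF ?fF'.
Qed.

End IsoNode.

Definition iso_type (t r : ptree) : finType :=
  {f : {ffun vertex t -> vertex r} | `[< is_iso f >]}.

Definition bij_type m n : finType :=
  {s : {ffun 'I_m -> 'I_n} | `[< bijective s >]}.

Lemma sigmaE t : sigma t = #|iso_type t t|.
Proof. by rewrite /sigma card_sig. Qed.

Lemma iso_typeP t r (x : iso_type t r) : is_iso (val x).
Proof. by have /asboolP := valP x. Qed.

Lemma is_iso_ffun t r (f : vertex t -> vertex r) : is_iso f ->
  `[< is_iso (finfun f) >].
Proof.
move=> fi; apply/asboolP; rewrite (_ : finfun f = f :> (_ -> _))//.
by apply/funext => u; rewrite ffunE.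
Qed.

Lemma iso_iso_type t r (x : iso_type t r) : iso t r.
Proof. by apply/asboolP; exists (val x); exact: iso_typeP. Qed.

(** Precomposition with an isomorphism is injective; used in both directions, it compares the
    isomorphisms onto [r] with the automorphisms of [r]. *)
Lemma card_iso_type t r : #|iso_type t r| = if iso t r then sigma r else 0%N.
Proof.
have le_card t1 t2 : iso t1 t2 -> (#|iso_type t2 r| <= #|iso_type t1 r|)%N.
  move=> /asboolP[h hi].
  pose G (x : iso_type t2 r) : iso_type t1 r :=
    exist _ (finfun (val x \o h)) (is_iso_ffun (is_iso_comp hi (iso_typeP x))).
  apply: (leq_card G) => x y /(congr1 val)/ffunP xy; apply/val_inj/ffunP => u.
  by have [[h' _ hK] _ _] := hi; have := xy (h' u); rewrite !ffunE /= hK.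
case: ifPn => [tr|Ntr]; last by apply: eq_card0 => x; case/negP: Ntr; exact: iso_iso_type x.
rewrite sigmaE; apply/eqP; rewrite eqn_leq !le_card//.
by rewrite iso_sym.
Qed.

(** An isomorphism amounts to a bijection between the branches together with an isomorphism of each
    branch onto its image. *)
Lemma card_iso_Node ts rs :
  #|iso_type (Node ts) (Node rs)| =
  (\sum_(s : bij_type (size ts) (size rs))
     \prod_(k < size ts) #|iso_type (nth leaf ts k) (nth leaf rs (val s k))|)%N.
Proof.
pose T (s : bij_type (size ts) (size rs)) : finType :=
  {dffun forall k : 'I_(size ts), iso_type (nth leaf ts k) (nth leaf rs (val s k))}.
transitivity #|{: {s : bij_type (size ts) (size rs) & T s}}|; last first.
  rewrite card_tagged sumnE big_map big_enum /=; apply: eq_bigr => s _.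
  by rewrite card_dep_ffun foldrE big_map big_enum.
have ex_f (x : {s : bij_type (size ts) (size rs) & T s}) :
    exists f : iso_type (Node ts) (Node rs),
      branch_iso (val f) (fun k => val (tagged x k)).
  have [|k|f fi fF] := @branch_iso_is_iso ts rs (val (tag x)) (fun k => val (tagged x k)).
  - by have /asboolP := valP (tag x).
  - exact: iso_typeP.
  by exists (exist _ (finfun f) (is_iso_ffun fi)) => k v /=; rewrite ffunE fF.
have [E EP] := choice ex_f.
have EI : injective E.
  move=> [s F] [s' F'] /= EE.
  have FF (k : 'I_(size ts)) (v : vertex (nth leaf ts k)) :
      graft (val (F k) v) = graft (val (F' k) v).
    by rewrite -(EP (Tagged T F)) EE (EP (Tagged T F')).
  have ss : s = s'.
    by apply/val_inj/ffunP => k; exact: graft_inj1 (FF k (troot _)).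
  subst s'; congr Tagged; apply/ffunP => k; apply/val_inj/ffunP => v.
  exact: graft_inj2 (FF k v).
have ES f : exists x, E x = f.
  have [s [F [sb Fi fF]]] := is_iso_branches (iso_typeP f).
  have sbf : `[< bijective (finfun s) >].
    by apply/asboolP; rewrite (_ : finfun s = s :> (_ -> _))//; apply/funext => u; rewrite ffunE.
  (* Once [s] is replaced by [val s'], the type of [F] matches that of [T s'] without transport. *)
  have [s' ss'] : exists s' : bij_type (size ts) (size rs), val s' = s :> (_ -> _).
    by exists (exist _ (finfun s) sbf); apply/funext => u; rewrite /= ffunE.
  subst s.
  pose F' : T s' := [ffun k => exist _ (finfun (F k)) (is_iso_ffun (Fi k))].
  exists (Tagged T F'); apply/val_inj/ffunP.
  apply: (branch_iso_eq (iso_typeP _) (iso_typeP _) (EP _)) => k v.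
  by rewrite fF /= ffunE /= ffunE.
apply/esym/(bij_eq_card (f := E)).
exists (fun f => projT1 (cid (ES f))) => [x|f].
  by apply: EI; exact: (projT2 (cid (ES (E x)))).
exact: (projT2 (cid (ES f))).
Qed.

(** * Regrouping plane trees into classes *)

Local Open Scope quotient_scope.

Lemma bij_type_eq m n (s : bij_type m n) : m = n.
Proof. by have /asboolP/bij_eq_card := valP s; rewrite !card_ord. Qed.

Lemma card_bij_type n : #|bij_type n n| = n`!.
Proof.
have := card_inj_ffuns 'I_n 'I_n; rewrite card_sig card_ord ffactnn => <-.
rewrite cardsE.
apply: eq_card => f; rewrite !inE; apply/asboolP/injectiveP => [/bij_inj//|].
exact: injF_bij.
Qed.

Lemma card_iso_Node_size ts rs m : size ts = m ->
  #|iso_type (Node ts) (Node rs)| =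
  (\sum_(s : bij_type m (size rs))
     \prod_(k < m) #|iso_type (nth leaf ts k) (nth leaf rs (val s k))|)%N.
Proof. by move=> <-; exact: card_iso_Node. Qed.

Lemma iso_torder t r : iso t r -> torder t = torder r.
Proof. by move=> /asboolP[f [/bij_eq_card]]. Qed.

(* Pairs of a plane tree [t] and an isomorphism from [t] to [r] are the orderings
   of the branches at every vertex of [r]; there are [1 / plane_coef r] of them. *)
Lemma sum_plane_coef (R : realType) N h r : (torder r <= h)%N -> (torder r <= N.+1)%N ->
  \sum_(t <- plane_trees N h) plane_coef R t * #|iso_type t r|%:R = 1.
Proof.
elim: h r => [|h IH] [rs]; first by rewrite leqn0 -[_ == 0%N]negbK -lt0n torder_gt0.
rewrite torder_Node !ltnS => rh rN.
have rle k : (k < size rs)%N ->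
    (torder (nth leaf rs k) <= \sum_(t <- rs) torder t)%N.
  by move=> krs; rewrite (big_rem (nth leaf rs k)) ?mem_nth//= leq_addr.
have mN : (size rs < N.+1)%N.
  rewrite ltnS (leq_trans _ rN)// -sum1_size.
  by apply: leq_sum => t _; exact: torder_gt0.
rewrite big_plane_trees (bigD1 (Ordinal mN))//= [X in _ + X]big1 ?addr0; last first.
  move=> m mrs; apply: big1_seq => w /andP[_ /size_words sw].
  suff -> : #|iso_type (Node w) (Node rs)| = 0%N by rewrite mulr0.
  rewrite (card_iso_Node_size _ sw) big_pred0// => s.
  by move: mrs; rewrite -(inj_eq val_inj) /= (bij_type_eq s) eqxx.
(* After sum and product are exchanged, every factor is 1 by induction, and the m! bijections cancel
   1/m!. *)
have -> : \sum_(w <- words (plane_trees N h) (size rs))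
      plane_coef R (Node w) * #|iso_type (Node w) (Node rs)|%:R =
    \sum_(s : bij_type (size rs) (size rs)) (size rs)`!%:R^-1 *
      \prod_(k < size rs) \sum_(t <- plane_trees N h)
         plane_coef R t * #|iso_type t (nth leaf rs (val s k))|%:R.
  under [RHS]eq_bigr do rewrite (prod_sum_words _ leaf) mulr_sumr.
  rewrite exchange_big; apply: eq_big_seq => w /size_words sw.
  rewrite (card_iso_Node_size _ sw) (plane_coef_Node R sw) natr_sum mulr_sumr.
  by apply: eq_bigr => s _; rewrite natr_prod -mulrA -big_split.
under eq_bigr => s _.
  rewrite big1 ?mulr1; last first.
    move=> k _; have kr := rle _ (ltn_ord (val s k)).
    by apply: IH; rewrite (leq_trans kr)// (leq_trans rN).
  over.
by rewrite sumr_const card_bij_type -(mulr_natr _^-1) mulVf// pnatr_eq0 -lt0n fact_gt0.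
Qed.

Lemma iso_branches ts rs : iso (Node ts) (Node rs) ->
  exists2 s : 'I_(size ts) -> 'I_(size rs), bijective s &
    forall k : 'I_(size ts), iso (nth leaf ts k) (nth leaf rs (s k)).
Proof.
move=> /asboolP[f fi]; have [s [F [sb Fi _]]] := is_iso_branches fi.
by exists s => // k; apply/asboolP; exists (F k).
Qed.

Lemma weight_poly_iso (R : realType) t r : iso t r -> weight_poly R t = weight_poly R r.
Proof.
elim/ptree_nth_ind: t r => ts IH [rs] /iso_branches[s sb sP].
rewrite !(weight_poly_Node _ (erefl _)) [in RHS](reindex s (onW_bij _ sb)).
by congr weight_integral; apply: eq_bigr => k _; exact: IH.
Qed.

(** Permuting the branches permutes the summation indices, and mixed derivatives do not depend on
    the order. *)
Lemma elementary_differential_iso (R : realType) d (X : 'I_d -> phase R d -> R) t r u :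
  (forall i, smooth (X i)) -> iso t r ->
  elementary_differential X t u = elementary_differential X r u.
Proof.
move=> sX; elim/ptree_nth_ind: t r u => ts IH [rs] u /iso_branches[s sb sP].
rewrite !(elementary_differential_Node _ _ (erefl _)); apply/funext => z.
have [s' sK s'K] := sb.
pose h (j : (size rs).-tuple 'I_d) := [tuple tnth j (s k) | k < size ts].
have hb : bijective h.
  exists (fun i : (size ts).-tuple 'I_d => [tuple tnth i (s' k) | k < size rs]) => i;
    by apply: eq_from_tnth => k; rewrite !tnth_mktuple ?sK ?s'K.
rewrite (reindex h (onW_bij _ hb)); apply: eq_bigr => j _; congr (_ * _).
  rewrite (@dxs_perm _ _ (h j) j)//.
  rewrite /h /= (_ : tval j = map (tnth j) (enum 'I_(size rs))); last by rewrite map_tnth_enum.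
  rewrite (map_comp (tnth j) s); apply: perm_map; apply: uniq_perm => [||k].
  - by rewrite map_inj_uniq ?enum_uniq//; exact: bij_inj.
  - exact: enum_uniq.
  - by rewrite mem_enum inE; apply/mapP; exists (s' k); rewrite ?mem_enum ?s'K.
rewrite [RHS](reindex s (onW_bij _ sb)); apply: eq_bigr => k _.
by rewrite tnth_mktuple (IH k (ltn_ord k) _ _ (sP k)).
Qed.

Lemma sum_RT (R : realType) N h n (g : ptree -> R) : (n <= h)%N -> (n <= N.+1)%N ->
  (forall t r, iso t r -> g t = g r) ->
  \sum_(t \in [set t : RT | torder (repr t) = n]%classic)
    (sigma (repr t))%:R^-1 * g (repr t) =
  \sum_(t <- plane_trees N h | torder t == n) plane_coef R t * g t.
Proof.
move=> nh nN gi.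
have piP (t : ptree) (x : RT) : (\pi_RT t == x) = iso t (repr x).
  by rewrite -{1}(reprK x) eqmodE.
pose L := [seq t <- plane_trees N h | torder t == n].
(* The classes of the listed plane trees exhaust those of order [n], so the sum over a set becomes a
   sum over a list. *)
pose S := undup [seq \pi_RT t | t <- L].
have -> : [set t : RT | torder (repr t) = n]%classic = [set` S]%classic.
  apply/seteqP; split=> x /=.
    move=> xn; rewrite mem_undup; apply/mapP; exists (repr x); last by rewrite reprK.
    by rewrite mem_filter xn eqxx mem_plane_trees// xn.
  rewrite mem_undup => /mapP[t]; rewrite mem_filter => /andP[/eqP <- _] /esym/eqP.
  by rewrite piP => /iso_torder.
rewrite -fsbig_seq ?undup_uniq// -[in RHS]big_filter -/L.
have E (x : RT) : x \in S -> (sigma (repr x))%:R^-1 * g (repr x) =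
    \sum_(t <- L) plane_coef R t * g t * (\pi_RT t == x)%:R.
  rewrite mem_undup => /mapP[t0]; rewrite mem_filter => /andP[/eqP t0n _] /esym/eqP.
  rewrite piP => t0x; have xn : torder (repr x) = n by rewrite -(iso_torder t0x).
  have s0 : (sigma (repr x))%:R != 0 :> R.
    have idi : is_iso (@id (vertex (repr x))) by split=> //; exists id.
    rewrite pnatr_eq0 -lt0n sigmaE; apply/card_gt0P.
    by exists (exist _ (finfun id) (is_iso_ffun idi) : iso_type _ _).
  apply: (mulfI s0); rewrite mulrA divff// mul1r.
  (* The factor 1 is written as the sum over all plane trees; those of another order have no
     isomorphism onto [repr x]. *)
  rewrite -[LHS]mul1r -[X in X * _ = _](@sum_plane_coef R N h (repr x)) ?xn//.
  rewrite (bigID (fun t => torder t == n)) /= [X in (_ + X) * _]big1 ?addr0; last first.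
    move=> t tn; rewrite card_iso_type; case: ifP => [/iso_torder tx|_]; last by rewrite mulr0.
    by rewrite tx xn eqxx in tn.
  rewrite -big_filter -/L mulr_suml mulr_sumr; apply: eq_bigr => t _.
  rewrite card_iso_type piP; case: (boolP (iso t _)) => [/gi ->|_].
    by rewrite /= mulr1 mulrCA mulrA.
  by rewrite /= !mulr0 mul0r.
rewrite (eq_big_seq _ E) exchange_big /=; apply: eq_big_seq => t tL.
rewrite -mulr_sumr (bigD1_seq (\pi_RT t)) ?undup_uniq//=; last first.
  by rewrite mem_undup map_f.
rewrite eqxx big1 ?addr0 ?mulr1// => x; rewrite eq_sym => /negbTE ->//.
Qed.

(** * The realization *)

(** Used for the evaluation at theta = 0, which sends u(theta) to alpha = u(0). *)
Lemma taylor_morph (R : realType) d (A B : comNzRingType)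
    (c : {rmorphism R -> {poly A}}) (c' : {rmorphism R -> {poly B}})
    (h : {rmorphism {poly A} -> {poly B}}) (z : phase R d) N U f :
  (forall r, h (c r) = c' r) ->
  h (taylor c z N U f) = taylor c' z N (fun j => h (U j)) f.
Proof.
move=> hc; rewrite /taylor rmorph_sum; apply: eq_bigr => n _.
by rewrite rmorphM hc (jet_morph _ _ _ _ hc).
Qed.

Section Realization.
Variables (R : realType) (d : nat) (P : 'rV[R]_d -> 'M[R]_d).
Hypothesis sP : forall i j, smooth (fun x => P x i j).

Lemma smooth_phi i n : smooth (phi P i n).
Proof.
apply: smoothM; first exact: smooth_cst.
by apply: smooth_iter_LVbar => //; exact: smooth_xcoord.
Qed.

Lemma fcomp_phi (alpha : 'I_d -> fseries R d) z N (U : 'I_d -> {poly R}) i n :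
  (forall i, alpha i 0%N z = xcoord i z) ->
  (forall j, (U j)`_0 = 0) ->
  (forall j k, (0 < k <= N)%N -> (U j)`_k = alpha j k z) -> (n <= N)%N ->
  fcomp (phi P i) alpha n z = \sum_(m < n.+1) (m.+1)`!%:R^-1 *
    (taylor (@polyC R) z N U (iter m (LVbar P) (xcoord i)))`_(n - m).
Proof.
move=> a0 U0 UA nN; rewrite /fcomp /fsum; apply: eq_bigr => m _.
rewrite (fcomp_fun_taylor a0 U0 UA)//; last 2 first.
- exact: smooth_phi.
- by rewrite (leq_trans (leq_subr _ _)).
rewrite /phi taylorZ ?coefCM//.
by apply: smooth_iter_LVbar => //; exact: smooth_xcoord.
Qed.

Lemma karasev_unique alpha beta :
  karasev_realization P alpha -> karasev_realization P beta -> alpha = beta.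
Proof.
move=> [_ a0 aphi] [_ b0 bphi].
suff ab n i z : alpha i n z = beta i n z.
  by apply/funext => i; apply/funext => n; apply/funext => z.
elim/ltn_ind: n i => -[|n] IH i; first by rewrite a0 b0.
pose U (g : 'I_d -> fseries R d) j : {poly R} :=
  \poly_(k < n.+2) (if k == 0%N then 0 else g j k z).
have U0 g j : (U g j)`_0 = 0 by rewrite coef_poly.
have UE g j k : (0 < k <= n.+1)%N -> (U g j)`_k = g j k z.
  by move=> /andP[k0 kn]; rewrite coef_poly ltnS kn gtn_eqF.
have E g : (forall i, g i 0%N z = xcoord i z) ->
    fcomp (phi P i) g n.+1 z = g i n.+1 z + \sum_(m < n.+1) (m.+2)`!%:R^-1 *
      (taylor (@polyC R) z n.+1 (U g) (iter m.+1 (LVbar P) (xcoord i)))`_(n - m).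
  move=> g0; rewrite (fcomp_phi _ g0 (U0 g) (UE g))// big_ord_recl /=.
  by rewrite taylor_xcoord// invr1 mul1r subn0 coefD coefC add0r UE ?leqnn.
have := aphi i n.+1 z; rewrite -(bphi i n.+1 z) !E//.
(* These terms come from the iterates of index m + 1, so only coefficients of index at most [n]
   enter, and the induction hypothesis covers them. *)
rewrite (eq_bigr (fun m : 'I_n.+1 => (m.+2)`!%:R^-1 *
      (taylor (@polyC R) z n.+1 (U beta) (iter m.+1 (LVbar P) (xcoord i)))`_(n - m))).
  by move/addIr.
move=> m _; congr (_ * _); apply: (@taylor_eqmodX _ _ _ _ z n.+1 n); last exact: leq_subr.
move=> j [|k] kn; first by rewrite !U0.
by rewrite !UE ?(leqW kn)//; apply: IH; rewrite ltnS.
Qed.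

Local Notation B := (bseries (Vbar P)).

Definition tree_realization (i : 'I_d) : fseries R d := fun n z =>
  xseries i n z +
    \sum_(t \in [set t : RT | torder (repr t) = n]%classic)
        (sigma (repr t))%:R^-1 * (-1) ^+ torder (repr t)
        * tweight (repr t) 0
        * elementary_differential (Vbar P) (repr t) i z.

(** Any bounds that admit all plane trees with [n] vertices give the same coefficient. *)
Lemma tree_realization_bseries N h i n z : (n <= h)%N -> (n <= N.+1)%N ->
  tree_realization i n z = xseries i n z + ((B z N h i)`_n).[0].
Proof.
move=> nh nN; rewrite /tree_realization; congr (_ + _).
pose g t := (-1) ^+ torder t * tweight t 0 * elementary_differential (Vbar P) t i z.
transitivity (\sum_(t \in [set t : RT | torder (repr t) = n]%classic)
    (sigma (repr t))%:R^-1 * g (repr t)).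
  by apply: eq_fsbigr => t _; rewrite /g !mulrA.
rewrite (@sum_RT R N h)//; last first.
  move=> t r tr; rewrite /g !tweight_poly (iso_torder tr) (weight_poly_iso R tr).
  by rewrite (elementary_differential_iso i (smooth_Vbar sP) tr).
rewrite coef_bseries horner_sum; apply: eq_bigr => t _.
by rewrite hornerZ /bcoef /g tweight_poly; ring.
Qed.

Lemma smooth_tree_realization i n : smooth (tree_realization i n).
Proof.
rewrite (_ : tree_realization i n = fun z => xseries i n z +
    \sum_(t <- plane_trees n n | torder t == n)
      (plane_coef R t * (-1) ^+ torder t * (weight_poly R t).[0]) *
      elementary_differential (Vbar P) t i z).
  apply: smoothD.
    case: n => [|n]; first exact: smooth_xcoord.
    exact: smooth_cst.
  apply: smooth_sum => t; apply: smoothM; first exact: smooth_cst.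
  by apply: smooth_elementary_differential; exact: smooth_Vbar.
apply/funext => z; rewrite (@tree_realization_bseries n n)//; congr (_ + _).
rewrite coef_bseries horner_sum; apply: eq_bigr => t _.
by rewrite hornerZ /bcoef; ring.
Qed.

Lemma karasev_tree_realization : karasev_realization P tree_realization.
Proof.
have a0 i z : tree_realization i 0%N z = xcoord i z.
  by rewrite (@tree_realization_bseries 0 0)// coef0_bseries horner0 addr0.
split=> // [i n|i n z]; first exact: smooth_tree_realization.
(* N must be positive for [taylor_xcoord], and N iterations determine the solution modulo
   eps^{N+1}. *)
pose N := n.+1; pose U := B z N N.
have dU j : eqmodX N (dtheta (U j)) ('X * taylor (const2 R) z N U (Vbar P j)).
  move=> k kN; rewrite coef_dtheta (@bseries_eqmodX _ _ _ _ z N N j k kN).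
    by rewrite bseriesS; [|exact: smooth_Vbar]; rewrite coef_picard_step coefXM;
      case: k kN => [|k] kN /=; rewrite ?deriv0// derivN deriv_weight_integral opprK.
  exact: smooth_Vbar.
(* Every weight is a value of [weight_integral], hence has mean 0. *)
have intU j k : int01 (U j)`_k = 0.
  rewrite coef_bseries linear_sum big1// => -[ts] _ /=.
  by rewrite linearZ /= int01_weight_integral mulr0.
rewrite (@fcomp_phi _ z N (fun j => map_poly (horner_eval 0) (U j)))//.
- rewrite -(@int01_taylor_xcoord _ _ z N U intU n i isT).
  rewrite (int01_taylor_flow sP _ dU (@smooth_xcoord R d i) (leqnSn n)); last first.
    by move=> j; exact: coef0_bseries.
  have h0 r : map_poly (horner_eval 0) (const2 R r) = r%:P.
    by rewrite map_polyC /= horner_evalE hornerC.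
  apply: eq_bigr => m _; congr (_ * _).
  have := taylor_morph (h := map_poly (horner_eval 0)) (c' := @polyC R) z N U
    (iter m (LVbar P) (xcoord i)) h0.
  by move=> <-; rewrite coef_map /= horner_evalE.
- by move=> j; rewrite coef_map /= coef0_bseries horner_evalE horner0.
- move=> j k /andP[k0 kN]; rewrite coef_map /= horner_evalE.
  rewrite (@tree_realization_bseries N N)// ?(leq_trans kN)//.
  by rewrite /xseries gtn_eqF// add0r.
Qed.

End Realization.

Theorem theorem24 (R : realType) (d : nat) (P : 'rV[R]_d -> 'M[R]_d)
    (hP : poisson_structure P) :
  (exists! alpha : 'I_d -> fseries R d, karasev_realization P alpha) /\
  forall alpha : 'I_d -> fseries R d, karasev_realization P alpha ->
  forall (i : 'I_d) (n : nat) (x p : 'rV[R]_d),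
    alpha i n (x, p) = xseries i n (x, p) +
      \sum_(t \in [set t : RT | torder (repr t) = n]%classic)
        (sigma (repr t))%:R^-1 * (-1) ^+ torder (repr t)
        * tweight (repr t) 0
        * elementary_differential (Vbar P) (repr t) i (x, p).
Proof.
have kP := karasev_tree_realization (poisson_smooth hP).
split.
  exists (tree_realization P); split=> // beta bP.
  by apply: (karasev_unique (poisson_smooth hP)).
move=> alpha aP i n x p.
by rewrite (karasev_unique (poisson_smooth hP) aP kP).
Qed.
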